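(* Let $n,k,d$ be integers with $1\le k\le n-1$ and $d\ge 2$, and let $\mathcal{T}_d^{(n,k)}$ be the class of trees with boundary having $n$ vertices, exactly $k$ of them interior, such that every interior vertex has degree at least $d$. A tree $G\in\mathcal{T}_d^{(n,k)}$ has the Faber-Krahn property in $\mathcal{T}_d^{(n,k)}$ if and only if $G$ is an SLO$^\ast$-tree in which one interior vertex has degree $d^\circ=d+\sum_{v\in V_0}(d_v-d)$ and all other interior vertices have degree $d$ (here $d_v$ denotes the degree of $v$ in $G$; note $\sum_{v\in V_0}d_v=n+k-2$ for every tree in the class). Such a $G$ is uniquely determined up to isomorphism.
   Context: A tree with boundary is a finite tree $G=(V,E)$ whose vertex set is partitioned into the set $\partial V$ of boundary vertices, which are exactly the vertices of degree $1$, and the set $V_0$ of interior vertices, which are exactly the vertices of degree at least $2$; both sets are nonempty. The Dirichlet operator $\Delta_0$ is the principal submatrix of the graph Laplacian $D-A$ of $G$ (degrees taken in $G$) indexed by $V_0$; $\lambda(G)$ is its smallest eigenvalue. $G$ has the Faber-Krahn property in a class $\mathcal{C}\ni G$ if $\lambda(G)\le\lambda(H)$ for all $H\in\mathcal{C}$. For a tree with a chosen root $v_0$, the height of $v$ is $h(v)=\mathrm{dist}(v,v_0)$; if $v,w$ are adjacent and $h(w)=h(v)+1$, then $v$ is the parent of $w$ and $w$ a child of $v$. A total order $\prec$ on $V$ is spiral-like (SLO) for root $v_0$ if for all vertices: (S1) $v\prec w$ implies $h(v)\le h(w)$; (S2) if $v_1\prec v_2$ then every child of $v_1$ precedes every child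 of $v_2$; (S3) if $v\prec w$ and $v\in\partial V$ then $w\in\partial V$. It is an SLO$^\ast$-ordering if additionally (S4) for interior vertices $v\prec w$ implies $d_v\le d_w$. An SLO$^\ast$-tree is a tree with boundary admitting an SLO$^\ast$-ordering for some root. *)

(* Defs.v *)
From HB Require Import structures.
From mathcomp Require Import all_boot all_order all_algebra.
From mathcomp Require Import fingroup perm reals.
Set Implicit Arguments.
Unset Strict Implicit.
Unset Printing Implicit Defensive.
Import Order.TTheory GRing.Theory Num.Theory.

Section Trees.
Variable n : nat.
Notation V := 'I_n.

Definition simple_graph (e : rel V) : Prop :=
  (forall x y, e x y = e y x) /\ (forall x, ~~ e x x).

Definition deg (e : rel V) (v : V) : nat := #|[set w | e v w]|.

Definition connected_graph (e : rel V) : Prop := forall x y, connect e x y.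

Definition acyclic (e : rel V) : Prop :=
  ~ exists (x : V) (p : seq V), [/\ uniq (x :: p), 2 <= size p & path.cycle e (x :: p)].

Definition is_tree (e : rel V) : Prop :=
  [/\ simple_graph e, connected_graph e & acyclic e].

Definition boundary (e : rel V) : {set V} := [set v | deg e v == 1].
Definition interior (e : rel V) : {set V} := [set v | 2 <= deg e v].

Definition tree_with_boundary (e : rel V) : Prop :=
  [/\ is_tree e, (forall v, 1 <= deg e v),
      boundary e != set0 & interior e != set0].

Definition in_class (k d : nat) (e : rel V) : Prop :=
  [/\ tree_with_boundary e, #|interior e| = k &
      forall v, v \in interior e -> d <= deg e v].

(* Graph Laplacian D - A and Dirichlet operator (principal submatrix on V_0,
   indexed by 'I_#|V_0| via the enumeration of V_0). *)
Definition laplacian (R : nzRingType) (e : rel V) : 'M[R]_n :=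
  \matrix_(i, j) (if i == j then (deg e i)%:R else if e i j then -1 else 0)%R.

Definition dirichlet (R : nzRingType) (e : rel V) : 'M[R]_#|interior e| :=
  \matrix_(i, j) laplacian R e (enum_val i) (enum_val j).

Definition is_lambda (R : realType) (e : rel V) (l : R) : Prop :=
  eigenvalue (dirichlet R e) l /\
  (forall m : R, eigenvalue (dirichlet R e) m -> (l <= m)%R).

Definition faber_krahn (R : realType) (k d : nat) (e : rel V) : Prop :=
  forall e' : rel V, in_class k d e' ->
    forall l l' : R, is_lambda e l -> is_lambda e' l' -> (l <= l')%R.

Fixpoint ball (e : rel V) (x : V) (m : nat) : {set V} :=
  if m is m'.+1 then
    ball e x m' :|: [set y | [exists z in ball e x m', e z y]]
  else [set x].

Definition dist (e : rel V) (x y : V) : nat :=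
  find (fun m => y \in ball e x m) (iota 0 n).

Definition height (e : rel V) (v0 v : V) : nat := dist e v v0.

Definition child (e : rel V) (v0 v w : V) : bool :=
  e v w && (height e v0 w == (height e v0 v).+1).

Definition strict_total_order (prec : rel V) : Prop :=
  [/\ (forall x, ~~ prec x x),
      (forall x y z, prec x y -> prec y z -> prec x z) &
      (forall x y, x != y -> prec x y || prec y x)].

Definition SLO (e : rel V) (v0 : V) (prec : rel V) : Prop :=
  [/\ strict_total_order prec,
   (* S1 *) (forall v w, prec v w -> height e v0 v <= height e v0 w),
   (* S2 *) (forall v1 v2 w1 w2, prec v1 v2 -> child e v0 v1 w1 ->
                child e v0 v2 w2 -> prec w1 w2) &
   (* S3 *) (forall v w, prec v w -> v \in boundary e -> w \in boundary e)].

Definition SLOstar (e : rel V) (v0 : V) (prec : rel V) : Prop :=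
  SLO e v0 prec /\
  (* S4 *) (forall v w, v \in interior e -> w \in interior e ->
               prec v w -> deg e v <= deg e w).

Definition SLOstar_tree (e : rel V) : Prop :=
  tree_with_boundary e /\ exists (v0 : V) (prec : rel V), SLOstar e v0 prec.

Definition extremal_degrees (d : nat) (e : rel V) : Prop :=
  exists2 u, u \in interior e &
    deg e u = d + \sum_(v in interior e) (deg e v - d) /\
    forall v, v \in interior e -> v != u -> deg e v = d.

Definition graph_iso (e e' : rel V) : Prop :=
  exists f : {perm V}, forall x y, e' (f x) (f y) = e x y.

End Trees.

(* Main.v *)
Require Import Defs.
From HB Require Import structures.
From mathcomp Require Import all_boot all_order all_algebra.
From mathcomp Require Import reals.
From mathcomp Require Import fingroup perm zify ring lra.
From mathcomp Require topology normedtype derive.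

(** For a nonnegative [f] vanishing on the boundary, the Dirichlet form is
    [sum_v d_v f(v)^2 - 2 sum_(uv) f(u) f(v)].  Writing [f] as a nonnegative combination
    of indicators of its superlevel sets turns it into a nonnegative combination of
    numbers of edges leaving [A] from a subset [C], for [C <= A] superlevel sets.  In a
    tree of the class at least [(d-1)|C| + 2 - |A|] edges do so, since at most
    [|C| - 1 + |A| - 1] (ordered) edges join [C] to [A].  In the tree filled in
    breadth-first order all these bounds are attained by the initial segments of the
    order, so it minimises the Rayleigh quotient.

    If a tree [G] attains the minimum, its positive ground state [f], transported along
    any enumeration of the vertices by decreasing [f], is an eigenvector of the
    breadth-first tree too.  Testing both eigenvector equations against indicators shows
    that the bound is attained for every superlevel set and every set obtained from one by
    adding part of the next level.  This forces the degrees of [G], and that children of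
    vertices with larger [f] have larger [f]; sorting by [f] with ties broken by the order
    of the parents is then an SLO*-ordering. *)

Set Implicit Arguments.
Unset Strict Implicit.
Unset Printing Implicit Defensive.
Import Order.TTheory GRing.Theory Num.Theory.

(** * Minimisation of quadratic forms on the unit sphere *)

Section Sphere.
Import boolp classical_sets topology normedtype derive.
Import numFieldNormedType.Exports.
Local Open Scope ring_scope.
Local Open Scope classical_set_scope.

(** The sphere is compact and the form continuous; this supplies a lowest eigenvector without
    diagonalisation. *)
Lemma quadratic_sphere_min (R : realType) m (Q : 'I_m -> 'I_m -> R) : (0 < m)%N ->
  exists2 v : 'rV[R]_m, \sum_i v ord0 i ^+ 2 = 1 &
    forall w : 'rV[R]_m, \sum_i w ord0 i ^+ 2 = 1 ->
      \sum_i \sum_j v ord0 i * v ord0 j * Q i j <= \sum_i \sum_j w ord0 i * w ord0 j * Q i j.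
Proof.
move=> m0.
have coord i : continuous (fun v : 'rV[R]_m => v ord0 i) by exact: coord_continuous.
have csum (I : Type) (s : seq I) (F : I -> 'rV[R]_m -> R) : (forall i, continuous (F i)) ->
    continuous (fun v => \sum_(i <- s) F i v).
  move=> cF; elim: s => [|i s IH] v.
    under eq_fun do rewrite big_nil; exact: cst_continuous.
  under eq_fun do rewrite big_cons; exact: cvgD (cF i v) (IH v).
pose N (v : 'rV[R]_m) := \sum_i v ord0 i ^+ 2.
have cN : continuous N.
  by apply: csum => i v; under eq_fun do rewrite expr2; exact: cvgM (coord i v) (coord i v).
pose A := N @^-1` [set 1].
have clA : closed A by apply: closed_comp => // v _; exact: cN.
have bA : bounded_set A.
  exists 1; split; first exact: num_real.
  move=> M M1 v; rewrite /A /= => Nv; apply: (@le_trans _ _ 1); last exact: ltW.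
  rewrite [`|v|]mx_normrE; apply/bigmax_leP; split=> // -[i j] _ /=.
  rewrite ord1 -(@expr_le1 _ 2) // real_normK ?num_real // -Nv /N (bigD1 j) //=.
  by rewrite lerDl; apply: sumr_ge0 => l _; exact: sqr_ge0.
have A0 : A !=set0.
  exists (delta_mx ord0 (Ordinal m0)); rewrite /A /= /N (bigD1 (Ordinal m0)) //= mxE !eqxx expr1n.
  rewrite big1 ?addr0 // => i; rewrite mxE => /negPf->; rewrite andbF expr0n //.
have cF : continuous (fun v : 'rV[R]_m => \sum_i \sum_j v ord0 i * v ord0 j * Q i j).
  apply: (csum) => i; apply: (csum) => j v.
  exact: cvgM (cvgM (coord i v) (coord j v)) (cvg_cst (Q i j)).
have [v vA vmin] := EVT_min_rV A0 (bounded_closed_compact bA clA) (continuous_subspaceT cF).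
exists v; first by move: vA; rewrite inE.
by move=> w Nw; apply: vmin; rewrite inE.
Qed.

End Sphere.

(** * Rooted trees *)
Section RootedTrees.
Variable n : nat.
Notation V := 'I_n.
Implicit Types (e : rel V) (r u v w x y : V) (A B C : {set V}).

(** A tree as a parent function. [h] need only grow away from the root, which rules out parent
    cycles; both the distance and the vertex number serve as [h]. *)
Definition rooted_at e r (par : V -> V) (h : V -> nat) : Prop :=
  (forall v, v != r -> h (par v) < h v) /\
  (forall u v, e u v = ((v != r) && (par v == u)) || ((u != r) && (par u == v))).

Lemma in_ballP e x m y :
  reflect (exists p, [/\ path e x p, last x p = y & size p <= m]) (y \in Defs.ball e x m).
Proof.
elim: m y => [|m IH] y /=.
  rewrite inE; apply: (iffP eqP) => [->|[[|z p] [_ /= <-]]] //.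
  by exists [::].
rewrite inE; apply: (iffP orP) => [[/IH[p [h1 h2 h3]]|]|].
- by exists p; split=> //; apply: leqW.
- rewrite inE => /existsP[z /andP[/IH[p [h1 h2 h3]] ezy]].
  exists (rcons p y); split; last by rewrite size_rcons.
    by rewrite rcons_path h1 h2.
  by rewrite last_rcons.
case=> p [+ + +]; case/lastP: p => [_ /= <- _|p z].
  by left; apply/IH; exists [::].
rewrite rcons_path last_rcons size_rcons ltnS => /andP[pp ez] <- sp.
right; rewrite inE; apply/existsP; exists (last x p); rewrite ez andbT.
by apply/IH; exists p.
Qed.

Section Heights.
Variables (e : rel V) (r : V).
Hypothesis conn : connected_graph e.

(** [dist] searches radii below [n] only; a repetition-free path to [r] has fewer than [n] edges, so
    the search succeeds. *)
Lemma height_in_ball v : r \in Defs.ball e v (height e r v).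
Proof.
have /connectP[p pp rE] := conn v r.
case/shortenP: pp rE => p' pp' up' _ lE.
have sp : size p' < n.
  by have := card_uniqP up'; have := max_card (mem (v :: p')); rewrite card_ord /= => + <-.
have hs : has (fun m => r \in Defs.ball e v m) (iota 0 n).
  apply/hasP; exists (size p'); first by rewrite mem_iota add0n.
  by apply/in_ballP; exists p'; split.
have := nth_find 0 hs; rewrite nth_iota ?add0n //.
by rewrite has_find size_iota in hs.
Qed.

Lemma height_min v m : r \in Defs.ball e v m -> height e r v <= m.
Proof.
move=> rb; rewrite leqNgt; apply/negP => lt_m.
have := before_find 0 lt_m; rewrite nth_iota ?add0n ?rb //.
by apply: leq_trans lt_m _; rewrite -[X in _ <= X](size_iota 0 n) find_size.
Qed.

Lemma height_eq0 v : (height e r v == 0) = (v == r).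
Proof.
apply/eqP/eqP => [h0|->]; last first.
  by apply/eqP; rewrite -leqn0; apply: height_min; rewrite /= inE.
by have := height_in_ball v; rewrite h0 /= inE => /eqP.
Qed.

Lemma height_adj v w : e v w -> height e r v <= (height e r w).+1.
Proof.
move=> evw; have /in_ballP[p [pp lp sp]] := height_in_ball w.
by apply: height_min; apply/in_ballP; exists (w :: p); split=> //=; rewrite evw.
Qed.

Lemma closer_neighbor v : v != r ->
  exists2 w, e v w & height e r v = (height e r w).+1.
Proof.
move=> vr; have /in_ballP[[|w p] [/= pp lp sp]] := height_in_ball v.
  by rewrite lp eqxx in vr.
case/andP: pp => evw pp; exists w => //.
apply/eqP; rewrite eqn_leq height_adj //=; apply: leq_ltn_trans sp.
by apply: height_min; apply/in_ballP; exists p.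
Qed.

End Heights.

Lemma rooted_connect e r par h : rooted_at e r par h -> forall v, connect e v r.
Proof.
case=> hpar eE v; move: {2}(h v) (leqnn (h v)) => m; elim: m v => [|m IH] v hv.
  by have [->//|/hpar] := eqVneq v r; case: (h v) hv.
have [->//|vr] := eqVneq v r.
have := hpar v vr => lt; apply: connect_trans (IH (par v) _); last by lia.
by apply: connect1; rewrite eE vr eqxx orbT.
Qed.

Lemma rooted_sym e r par h : rooted_at e r par h -> forall u v, e u v = e v u.
Proof. by case=> _ eE u v; rewrite !eE orbC. Qed.

(** On a cycle take a vertex with [h] maximal: its two neighbours there are distinct, yet both must
    be its parent. *)
Lemma rooted_is_tree e r par h : rooted_at e r par h -> is_tree e.
Proof.
move=> rt; have sym := rooted_sym rt; have [hpar eE] := rt.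
have irr x : ~~ e x x.
  by rewrite eE orbb negb_and; have [|/hpar] //= := eqVneq x r; apply: contraTneq => ->; rewrite ltnn.
split=> //.
  move=> x y; apply: connect_trans (rooted_connect rt x) _.
  by rewrite (sym_connect_sym sym); exact: rooted_connect rt y.
case=> x [p [ux sp cx]].
have [z zin zmax] : exists2 z, z \in x :: p & forall y, y \in x :: p -> h y <= h z.
  have xin : x \in x :: p by rewrite mem_head.
  by case: (arg_maxnP (P := [in x :: p]) h xin) => z zin zmax; exists z.
have [i q rotE] := rot_to zin.
have cz : path.cycle e (z :: q) by rewrite -rotE rot_cycle.
have uz : uniq (z :: q) by rewrite -rotE rot_uniq.
have sq : 2 <= size q by move: (congr1 size rotE) sp; rewrite size_rot /= => -[->].
have nb y : y \in q -> e z y -> y = par z.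
  move=> yq; rewrite eE => /orP[/andP[yr /eqP pz]|/andP[_ /eqP//]].
  have := hpar y yr; rewrite pz ltnNge zmax //.
  by rewrite -(mem_rot i) rotE inE yq orbT.
case: q {rotE} sq cz uz nb => [|a [|b q]] //= _ /and3P[eza eab pb] /and3P[_ aq _] nb.
have := nb a; rewrite mem_head => /(_ isT eza) aE.
move: pb aq; rewrite rcons_path => /andP[_ elz].
have := nb (last b q); rewrite inE mem_last orbT -aE sym => /(_ isT elz) <-.
by rewrite mem_last.
Qed.

(** Parents are neighbours one step closer to [r]. The parent edges already connect all vertices, so
    any further edge of [e] would close a cycle. *)
Lemma tree_rooted e r : is_tree e -> exists par, rooted_at e r par (height e r) /\
  forall v, v != r -> height e r v = (height e r (par v)).+1.
Proof.
case=> -[sym irr] conn acyc.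
pose par v := odflt v [pick w | e v w && (height e r v == (height e r w).+1)].
have parP v : v != r -> e v (par v) /\ height e r v = (height e r (par v)).+1.
  move=> vr; rewrite /par; case: pickP => [w /andP[-> /eqP]//|no].
  by have [w ew /eqP hw] := closer_neighbor conn vr; have := no w; rewrite ew hw.
exists par; split=> [|v /parP[]//].
split=> [v /parP[_ ->]//|u v].
pose t u v := ((v != r) && (par v == u)) || ((u != r) && (par u == v)).
have rt : rooted_at t r par (height e r) by split=> // w /parP[_ ->].
have te : subrel t e.
  move=> x y /orP[/andP[/parP[+ _] /eqP <-]|/andP[/parP[+ _] /eqP <-]] //.
  by rewrite sym.
apply/idP/idP => [euv|/te//]; rewrite -[_ || _]/(t u v).
apply: contraT => ntuv; case: acyc.
have [_ tconn _] := rooted_is_tree rt.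
have /connectP[p pp vE] := tconn u v.
case/shortenP: pp vE => p' pp' up' _ lE.
exists u, p'; split=> //; last first.
  by rewrite /= rcons_path -lE (sub_path te) //= sym.
case: p' pp' up' lE => [|a [|b p']] //= pp' _ lE.
  by move: euv; rewrite lE; apply/contraTT.
by move: pp'; rewrite -lE andbT (negPf ntuv).
Qed.

(** Ordered pairs are counted: an edge inside [A :&: B] counts twice. *)
Definition edges e A B : nat := \sum_(u in A) \sum_(v in B) e u v.

Lemma deg_sum e v : deg e v = \sum_w e v w.
Proof. by rewrite /deg -sum1_card big_mkcond; apply: eq_bigr => w _; rewrite inE; case: (e v w). Qed.

Lemma edges_setT e A : edges e A setT = \sum_(u in A) deg e u.
Proof. by apply: eq_bigr => u _; rewrite deg_sum; apply: eq_bigl => w; rewrite inE. Qed.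

Lemma edges_setC e A B : edges e A B + edges e A (~: B) = \sum_(u in A) deg e u.
Proof.
rewrite -big_split; apply: eq_bigr => u _ /=; rewrite deg_sum.
rewrite [RHS](bigID [in B]) /=; congr (_ + _).
by apply: eq_bigl => w; rewrite inE.
Qed.

Lemma rooted_edges e r par h A B : rooted_at e r par h ->
  edges e A B = #|[set w in B | (w != r) && (par w \in A)]| +
                #|[set w in A | (w != r) && (par w \in B)]|.
Proof.
case=> hpar eE.
(* No edge is a parent edge in both directions, since [h] drops from child to parent; so the
   disjunction is a sum. *)
have eN u v : e u v = ((v != r) && (par v == u)) + ((u != r) && (par u == v)) :> nat.
  rewrite eE; case: (boolP ((v != r) && _)) => [/andP[/hpar h1 /eqP <-]|//].
  case: (boolP ((par v != r) && _)) => [/andP[/hpar h2 /eqP pE]|] //=.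
  by rewrite pE ltnNge ltnW in h2.
rewrite /edges; under eq_bigr do under eq_bigr do rewrite eN.
under eq_bigr do rewrite big_split; rewrite big_split /= exchange_big /=.
have aux A' B' : \sum_(j in B') \sum_(i in A') ((j != r) && (par j == i)) =
    #|[set w in B' | (w != r) && (par w \in A')]|.
  rewrite -sum1_card [RHS]big_mkcond [LHS]big_mkcond; apply: eq_bigr => j _.
  rewrite !inE; case: (j \in B') => //=; case: (j != r) => /=; last by rewrite big1.
  case: (boolP (par j \in A')) => pA; last first.
    by rewrite big1 // => i iA; rewrite (_ : (_ == _) = false) //; apply: contraNF pA => /eqP->.
  by rewrite (bigD1 (par j)) //= eqxx big1 // => i /andP[_]; rewrite eq_sym => /negPf->.
by rewrite !aux.
Qed.

End RootedTrees.

(** * Edge counts *)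
Section EdgeCounts.
Variable n : nat.
Notation V := 'I_n.
Implicit Types (e : rel V) (r u v w x y : V) (A B C : {set V}).

Lemma rooted_par_interior e r par h : rooted_at e r par h -> r \in interior e ->
  forall w, w != r -> par w \in interior e.
Proof.
case=> hpar eE ri w wr; have [->//|pr] := eqVneq (par w) r.
rewrite inE /deg; have <- : #|[set w; par (par w)]| = 2.
  rewrite cards2; have [wE|//] := eqVneq w (par (par w)).
  by have := ltn_trans (hpar _ pr) (hpar _ wr); rewrite -wE ltnn.
apply/subset_leq_card/subsetP => x; rewrite !inE eE => /orP[/eqP->|/eqP->].
  by rewrite wr eqxx.
by rewrite pr eqxx orbT.
Qed.

(** Rooted at an interior vertex, every parent is interior, so each boundary vertex contributes
    exactly its parent edge. *)
Lemma interior_boundary_edges e : tree_with_boundary e ->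
  edges e (interior e) (~: interior e) = n - #|interior e|.
Proof.
case=> tr _ _ /set0Pn[r ri].
have [par [rt _]] := tree_rooted r tr.
have pin := rooted_par_interior rt ri.
rewrite (rooted_edges _ _ rt).
have -> : [set w in interior e | (w != r) && (par w \in ~: interior e)] = set0.
  apply/setP => w; rewrite in_set0 [LHS]in_set in_setC.
  by case: (eqVneq w r) => [|/pin->]; rewrite ?andbF.
rewrite cards0 addn0; have := cardsC (interior e); rewrite card_ord.
move/(canRL (addKn _)) <-.
apply: eq_card => w; rewrite [LHS]in_set in_setC.
by case: (eqVneq w r) => [->|/pin->]; rewrite ?ri ?andbT.
Qed.

(** Each edge is counted at its child end, and [r], lying in both sets, is nobody's child. *)
Lemma edges_in_le e r par h A C : rooted_at e r par h -> r \in C -> C \subset A ->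
  edges e C A <= #|A|.-1 + #|C|.-1.
Proof.
move=> rt rC /subsetP sCA; rewrite (rooted_edges _ _ rt).
have aux (D E : {set V}) : r \in D -> #|[set w in D | (w != r) && (par w \in E)]| <= #|D|.-1.
  move=> rD; rewrite [#|D|](cardsD1 r) rD; apply/subset_leq_card/subsetP => w.
  by rewrite !inE => /and3P[-> -> _].
by apply: leq_add; apply: aux => //; apply: sCA.
Qed.

Lemma degree_sum_ge k d e C : in_class k d e -> C \subset interior e ->
  d * #|C| <= \sum_(u in C) deg e u.
Proof.
case=> _ _ dmin /subsetP sC; rewrite mulnC -sum_nat_const.
by apply: leq_sum => u /sC; apply: dmin.
Qed.

(** With the root inside [C], [edges_in_le] limits how much of the degree sum of [C], at least
    [d * #|C|], can stay in [A]. *)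
Lemma edges_out_ge k d e A C : 2 <= d -> in_class k d e ->
  C != set0 -> C \subset A -> A \subset interior e ->
  d.-1 * #|C| + 2 - #|A| <= edges e C (~: A).
Proof.
move=> d2 cl /set0Pn[r rC] sCA sA.
have [[tr _ _ _] _ _] := cl; have [par [rt _]] := tree_rooted r tr.
have := edges_in_le rt rC sCA; have := edges_setC e C A.
have := degree_sum_ge cl (subset_trans sCA sA).
have : 0 < #|C| by apply/card_gt0P; exists r.
have := subset_leq_card sCA.
by case: d d2 {cl} => // d _ /=; rewrite mulSn; lia.
Qed.

(** Compare the lower bound for [C = A = interior e] with the exact number of boundary edges. *)
Lemma class_size k d e : 2 <= d -> in_class k d e -> d.-1 * k + 2 <= n.
Proof.
move=> d2 cl; have [tb ik _] := cl; have [_ _ _ i0] := tb.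
have := edges_out_ge d2 cl i0 (subxx _) (subxx _).
rewrite interior_boundary_edges // ik.
have kn : k <= n by rewrite -ik -[X in _ <= X]card_ord max_card.
case: d d2 {cl} => [|[|d]] // _ /=; rewrite mulSn; lia.
Qed.

Definition ord_prefix c : {set V} := [set i : V | i < c].

Lemma card_ord_prefix c : c <= n -> #|ord_prefix c| = c.
Proof.
move=> cn; rewrite -sum1_card (eq_bigl (fun i : V => i < c)) => [|i]; last by rewrite inE.
by rewrite -(big_ord_widen n (fun=> 1)) // sum_nat_const card_ord muln1.
Qed.

Lemma downset_ord_prefix (S : {set V}) :
  (forall i j : V, i < j -> j \in S -> i \in S) -> S = ord_prefix #|S|.
Proof.
move=> down; apply/setP => i; rewrite inE; apply/idP/idP => [iS|].
  rewrite -(card_ord_prefix (ltn_ord i)); apply/subset_leq_card/subsetP => j.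
  by rewrite inE ltnS leq_eqVlt => /orP[/eqP/val_inj->//|/down]; apply.
apply: contraLR => iS; rewrite -leqNgt -[X in _ <= X]card_ord_prefix; last exact: ltnW.
apply/subset_leq_card/subsetP => j jS; rewrite inE ltnNge leq_eqVlt.
by apply: contra iS => /orP[/eqP/val_inj->//|/down->].
Qed.

End EdgeCounts.

(** * The canonical extremal tree *)
(* Vertex [0] is the root; in breadth-first order the root has [d] children and
   every other interior vertex [d - 1], except that the last interior vertex
   [k - 1] takes all the remaining vertices.  The truncated [i - 2] accounts for
   the additional child [1] of the root. *)
Definition canon_par (k d i : nat) : nat := minn ((i - 2) %/ d.-1) k.-1.

Definition canon n (k d : nat) : rel 'I_n := fun i j =>
  ((j != 0 :> nat) && (canon_par k d j == i)) ||
  ((i != 0 :> nat) && (canon_par k d i == j)).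

(** The threshold counts the root, its [d] children and [d - 1] children for each of the other
    [c - 1] vertices; [c < k] keeps the last interior vertex out. *)
Lemma canon_par_lt k d i c : 2 <= d -> 0 < c < k ->
  (canon_par k d i < c) = (i < d.-1 * c + 2).
Proof.
move=> d2 /andP[c0 ck]; rewrite /canon_par gtn_min.
have -> : k.-1 < c = false by lia.
rewrite orbF ltn_divLR; last by lia.
have : 0 < d.-1 * c by rewrite muln_gt0 c0 andbT; lia.
by rewrite mulnC; lia.
Qed.

(** A number below [k] is determined by its comparisons with all [c], so a parent can be located by
    counting the children of initial segments. *)
Lemma canon_par_unique k d i m : 2 <= d -> m < k ->
  (forall c, 0 < c < k -> (m < c) = (i < d.-1 * c + 2)) -> m = canon_par k d i.
Proof.
move=> d2 mk mP.
have {}mP c : 0 < c < k -> (m < c) = (canon_par k d i < c).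
  by move=> ck; rewrite canon_par_lt // mP.
have lt : canon_par k d i < k by rewrite /canon_par; lia.
apply/eqP; rewrite eqn_leq; apply/andP; split; rewrite leqNgt; apply/negP => lt2.
  by have := mP m; rewrite ltnn lt2; lia.
by have := mP (canon_par k d i); rewrite ltnn lt2; lia.
Qed.

Section Canonical.
Variables n k d : nat.
Hypotheses (k_gt0 : 0 < k) (k_lt : k < n) (d_ge2 : 2 <= d) (size_ok : d.-1 * k + 2 <= n).
Notation V := 'I_n.
Notation T := (@canon n k d).

Let canon_par_ltn i : canon_par k d i < n.
Proof. by rewrite /canon_par; lia. Qed.

Let root : V := Ordinal (leq_ltn_trans (leq0n k) k_lt).
Let cpar (i : V) : V := Ordinal (canon_par_ltn i).

Lemma canon_rooted : rooted_at T root cpar val.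
Proof.
split=> [v|u v]; last by [].
rewrite -val_eqE /= /canon_par -lt0n => v0.
have := leq_div (v - 2) d.-1; lia.
Qed.

Lemma canon_children c :
  #|[set w : V | (w != root) && (cpar w \in ord_prefix n c)]| =
  if c == 0 then 0 else if c < k then (d.-1 * c).+1 else n.-1.
Proof.
have [->|c0] := eqVneq c 0.
  by apply: eq_card0 => w; rewrite !inE ltn0 andbF.
set m := if c < k then d.-1 * c + 2 else n.
have mn : m <= n.
  by rewrite /m; case: ltnP => // ck; apply: leq_trans size_ok; rewrite leq_add2r leq_mul2l ltnW ?orbT.
transitivity #|ord_prefix n m :\ root|.
  apply: eq_card => w; rewrite !inE; congr (_ && _); rewrite /m /cpar /=.
  case: (ltnP c k) => ck; first by rewrite canon_par_lt // lt0n c0.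
  by rewrite ltn_ord; rewrite /canon_par; lia.
have := cardsD1 root (ord_prefix n m); rewrite card_ord_prefix // inE /=.
have -> : 0 < m by rewrite /m; case: (ltnP c k) => _; [rewrite addn2 | apply: leq_ltn_trans k_lt].
by rewrite add1n => mE; rewrite -[LHS]/(_.+1.-1) -mE /m; case: (ltnP c k); rewrite ?addn2.
Qed.

Lemma canon_degree_sum c : c <= n ->
  \sum_(u in ord_prefix n c) deg T u =
  if c == 0 then 0 else if c < k then d * c else n.-1 + c.-1.
Proof.
move=> cn; rewrite -edges_setT (rooted_edges _ _ canon_rooted).
have -> : [set w in setT | (w != root) && (cpar w \in ord_prefix n c)] =
          [set w | (w != root) && (cpar w \in ord_prefix n c)].
  by apply/setP => w; rewrite !inE.
rewrite canon_children.
have -> : [set w in ord_prefix n c | (w != root) && (cpar w \in setT)] = ord_prefix n c :\ root.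
  by apply/setP => w; rewrite !inE andbT andbC.
have := cardsD1 root (ord_prefix n c); rewrite card_ord_prefix // inE /=.
have [->|c0] := eqVneq c 0; first by rewrite ltnn => <-.
rewrite lt0n c0 add1n => cE; have -> : #|ord_prefix n c :\ root| = c.-1 by rewrite {2}cE.
by case: (ltnP c k) => // ck; case: d d_ge2 => // d' _ /=; rewrite mulSn; lia.
Qed.

(** Degrees are differences of consecutive prefix sums. *)
Lemma canon_deg (i : V) :
  deg T i = if i < k.-1 then d else if i < k then n + k - 2 - d * k.-1 else 1.
Proof.
have := canon_degree_sum (ltn_ord i); have := canon_degree_sum (ltnW (ltn_ord i)).
have iP : i \in ord_prefix n i.+1 by rewrite inE.
rewrite [\sum_(u in ord_prefix n i.+1) _](bigD1 i) //= => D0.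
rewrite (eq_bigl [in ord_prefix n i]) => [|u]; last first.
  by rewrite !inE ltnS [RHS]ltn_neqAle andbC.
rewrite D0 {D0}.
case: (ltnP i k.-1) => h1.
  have -> : i.+1 < k by lia.
  have -> : i < k by lia.
  by rewrite mulnS; case: (eqVneq (i : nat) 0) => [->|]; lia.
have -> : (i.+1 < k) = false by lia.
have [h2|h2] := ltnP i k; last by have -> : (i : nat) == 0 = false; lia.
have iE : (i : nat) = k.-1 by lia.
by rewrite iE; case: (eqVneq k.-1 0) => k0; rewrite ?k0 ?muln0 /=; lia.
Qed.

Lemma canon_interior : interior T = ord_prefix n k.
Proof.
apply/setP => i; rewrite !inE canon_deg.
have [h|h] := ltnP i k.-1; first by rewrite d_ge2; lia.
have [h2|h2] := ltnP i k; last by lia.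
have := size_ok; rewrite -[in d.-1 * k](prednK k_gt0) mulnS.
by case: d d_ge2 => // d' d'1 /=; rewrite mulSn; lia.
Qed.

Lemma canon_in_class : in_class k d T.
Proof.
split; last first.
- move=> v; rewrite canon_interior inE canon_deg => ->; case: ltnP => // h.
  have := size_ok; rewrite -[in d.-1 * k](prednK k_gt0) mulnS.
  by case: d d_ge2 => // d' d'1 /=; rewrite mulSn; lia.
- by rewrite canon_interior card_ord_prefix // ltnW.
split.
- exact: rooted_is_tree canon_rooted.
- move=> v; have [vk|vk] := ltnP v k.
    have : v \in interior T by rewrite canon_interior inE.
    by rewrite inE => /ltnW.
  rewrite canon_deg (leq_gtF vk).
  by have -> : v < k.-1 = false by lia.
- apply/set0Pn; exists (Ordinal k_lt); rewrite inE canon_deg /= ltnn.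
  by have -> : k < k.-1 = false by lia.
- by apply/set0Pn; exists root; rewrite canon_interior inE.
Qed.

(** Parents have smaller numbers, so only edges to children leave; these children are numbered from
    [b] up to the threshold of [canon_par_lt]. The bound of [edges_out_ge] is attained. *)
Lemma canon_edges_out c b : 0 < c < k -> c <= b <= k ->
  edges T (ord_prefix n c) (~: ord_prefix n b) = d.-1 * c + 2 - b.
Proof.
move=> c0k /andP[cb bk]; rewrite (rooted_edges _ _ canon_rooted).
have -> : [set w in ord_prefix n c | (w != root) && (cpar w \in ~: ord_prefix n b)] = set0.
  apply/setP => w; rewrite !inE /= -leqNgt; apply/negP => /and3P[wc wr bw].
  by have [/(_ w wr) /= + _] := canon_rooted; lia.
have mn : d.-1 * c + 2 <= n.
  by apply: leq_trans size_ok; rewrite leq_add2r leq_mul2l; lia.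
rewrite cards0 addn0; transitivity #|ord_prefix n (d.-1 * c + 2) :\: ord_prefix n b|.
  apply: eq_card => w; rewrite !inE /cpar /= -leqNgt canon_par_lt // -val_eqE /=.
  by case: (leqP b w) => //= bw; have -> : w != 0 :> nat by lia.
rewrite cardsD card_ord_prefix //.
have -> : ord_prefix n (d.-1 * c + 2) :&: ord_prefix n b = ord_prefix n (minn (d.-1 * c + 2) b).
  by apply/setP => w; rewrite !inE leq_min.
rewrite card_ord_prefix; lia.
Qed.

End Canonical.

(** * SLO*-trees with extremal degrees are canonical *)
Section SLOCanonical.
Variable n : nat.
Notation V := 'I_n.
Implicit Types (e : rel V) (u v w x y : V).

Definition rank_of (P : rel V) u : nat := #|[set w | P w u]|.

Lemma rank_of_lt (P : rel V) u v : strict_total_order P ->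
  (rank_of P u < rank_of P v) = P u v.
Proof.
case=> irr trans tot.
have lt a b : P a b -> rank_of P a < rank_of P b.
  move=> ab; apply: proper_card; apply/properP; split.
    by apply/subsetP => w; rewrite !inE => /trans; apply.
  by exists a; rewrite inE // irr.
apply/idP/idP => [ltuv|/lt//].
have [uv|/tot/orP[//|/lt]] := eqVneq u v; first by rewrite uv ltnn in ltuv.
by rewrite ltnNge ltnW.
Qed.

Lemma rank_of_eq (P : rel V) u v : strict_total_order P ->
  (rank_of P u == rank_of P v) = (u == v).
Proof.
move=> sto; apply/eqP/eqP => [rE|->//]; apply/eqP; apply: contraT.
by case: (sto) => _ _ /[apply]; rewrite -!rank_of_lt // rE ltnn.
Qed.

Lemma strict_total_rank (prec : rel V) : strict_total_order prec ->
  exists rho : {perm V}, forall u v, (rho u < rho v) = prec u v.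
Proof.
move=> sto; have [irr _ _] := sto.
have rk_n v : rank_of prec v < n.
  rewrite -[X in _ < X](card_ord n) -cardsT; apply: proper_card.
  by apply/properP; split; [exact: subsetT | exists v; rewrite inE // irr].
have rk_inj : injective (fun v => Ordinal (rk_n v)).
  by move=> u v [/eqP]; rewrite rank_of_eq // => /eqP.
by exists (perm rk_inj) => u v; rewrite !permE /= rank_of_lt.
Qed.

Lemma imset_perm_downset (rho : {perm V}) (S : {set V}) :
  (forall u v, rho u < rho v -> v \in S -> u \in S) ->
  forall v, (v \in S) = (rho v < #|S|).
Proof.
move=> down v; rewrite -(mem_imset S v (@perm_inj _ rho)).
rewrite (@downset_ord_prefix n (rho @: S)) => [|i j ij /imsetP[w wS jE]].
  by rewrite inE card_imset //; apply: perm_inj.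
have [u iE] : exists u, i = rho u by exists (rho^-1%g i); rewrite permKV.
by rewrite iE mem_imset; [apply: down wS; rewrite -iE -jE | apply: perm_inj].
Qed.

(** By S3 interior vertices come first, by S4 the exceptional degree comes last among them, and by
    S2 the children of an initial segment form, with the root, an initial segment whose size the
    degrees dictate. This fixes the position of every parent. *)
Lemma SLOstar_canonical k d e : 0 < k -> k < n -> 2 <= d -> in_class k d e ->
  SLOstar_tree e -> extremal_degrees d e ->
  exists rho : {perm V}, forall x y, e x y = canon k d (rho x) (rho y).
Proof.
move=> k0 kn d2 cl [[tr deg1 _ int0]] [v0 [prec [[sto S1 S2 S3] S4]]] [u0 u0i [_ degu0]].
have [_ ik dmin] := cl.
have [rho rhoE] := strict_total_rank sto.
have [irr trans tot] := sto.
have [par [rt hpar]] := tree_rooted v0 tr.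
have [[sym irre] conn _] := tr; have [_ eE] := rt.
have childE u w : w != v0 -> par w = u -> child e v0 u w.
  by move=> wv <-; rewrite /child eE wv eqxx /= hpar.
have notbd v : (v \in boundary e) = (v \notin interior e).
  by rewrite !inE -leqNgt eqn_leq deg1 andbT.
have rho0 v : (rho v == 0 :> nat) = (v == v0).
  have first w : ~~ prec w v0.
    apply/negP => pw; have := S1 _ _ pw.
    have /eqP-> : height e v0 v0 == 0 by rewrite height_eq0.
    rewrite leqn0 height_eq0 // => /eqP wv; move: pw; rewrite wv.
    by apply/negP.
  apply/eqP/eqP => [rv|->].
    apply/eqP; apply: contraT => /tot/orP[]; first by apply/contraTT.
    by rewrite -rhoE rv.
  apply/eqP; rewrite -leqn0 leqNgt; apply/negP => lt.
  have := first (rho^-1%g (Ordinal (leq_ltn_trans (leq0n k) kn))).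
  by rewrite -rhoE permKV lt.
have intE v : (v \in interior e) = (rho v < k).
  rewrite -ik; apply: (@imset_perm_downset rho) => u w; rewrite rhoE => uw.
  by apply: contraLR; rewrite -!notbd; apply: S3.
have rhov0 : rho v0 = 0 :> nat by apply/eqP; rewrite rho0.
have v0i : v0 \in interior e by rewrite intE rhov0.
have degd v : rho v < k.-1 -> deg e v = d.
  move=> vk; have vi : v \in interior e by rewrite intE; lia.
  have [vu|] := eqVneq v u0; last exact: degu0.
  (* If the exceptional vertex came earlier, the vertex [z] in the last interior position would have
     degree [d], and S4 would bound [deg e v] by [d]. *)
  have kn1 : k.-1 < n by lia.
  pose z := rho^-1%g (Ordinal kn1).
  have zE : rho z = k.-1 :> nat by rewrite permKV.
  have zi : z \in interior e by rewrite intE; lia.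
  have vz : prec v z by rewrite -rhoE zE.
  have zu : z != u0 by apply: contraTneq vz => ->; rewrite vu irr.
  by apply/eqP; rewrite eqn_leq dmin // andbT -(degu0 z) // S4.
have parE w : w != v0 -> rho (par w) = canon_par k d (rho w) :> nat.
  move=> wv; apply: canon_par_unique => //.
    by rewrite -intE; apply: (rooted_par_interior rt).
  move=> c ck.
  pose C := [set v | rho v < c].
  have cC : #|C| = c.
    rewrite -(@card_ord_prefix n c); last by lia.
    rewrite -(card_imset (mem C) (@perm_inj _ rho)); apply: eq_card => i.
    rewrite inE; apply/imsetP/idP => [[v] + ->|ic]; first by rewrite inE.
    by exists (rho^-1%g i); rewrite ?inE permKV.
  pose S := [set v | (v != v0) && (par v \in C)].
  have v0C : v0 \in C by rewrite inE rhov0; lia.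
  (* The degree sum [d * c] counts the children in [S] and the [c - 1] parent edges of [C :\ v0]. *)
  have cS : #|S| = d.-1 * c + 1.
    have := edges_setT e C; rewrite (rooted_edges _ _ rt).
    have -> : \sum_(u in C) deg e u = d * c.
      rewrite -cC mulnC -sum_nat_const; apply: eq_bigr => u; rewrite inE => uc.
      by apply: degd; lia.
    have -> : [set w0 in setT | (w0 != v0) && (par w0 \in C)] = S.
      by apply/setP => x; rewrite !inE.
    have -> : [set w0 in C | (w0 != v0) && (par w0 \in setT)] = C :\ v0.
      by apply/setP => x; rewrite !inE andbT andbC.
    have := cardsD1 v0 C; rewrite v0C cC.
    case: d d2 {cl u0i degu0 dmin degd} => // d' _ /=; rewrite mulSn.
    by move: #|C :\ v0| #|S| (d' * c) => a b m; clear; lia.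
  (* If the parent of [v] preceded that of [u], S2 would place [v] before [u]. *)
  have down u v : rho u < rho v -> v \in v0 |: S -> u \in v0 |: S.
    rewrite rhoE => uv; rewrite ![_ \in v0 |: S]in_setU1.
    case: (eqVneq v v0) => [vv|vv] /=.
      by move: uv; rewrite -rhoE vv rhov0.
    case: (eqVneq u v0) => //= uv0; rewrite !inE vv uv0 /=; apply: leq_ltn_trans.
    rewrite leqNgt rhoE; apply/negP => pp.
    have := S2 _ _ _ _ pp (childE _ _ vv erefl) (childE _ _ uv0 erefl).
    by move=> /(trans _ _ _ uv); apply/negP.
  have := imset_perm_downset down w.
  rewrite in_setU1 (negPf wv) /= cardsU1 cS !inE wv eqxx /= => ->.
  by congr (_ < _); lia.
exists rho => x y; rewrite eE /canon !rho0.
have aux a b : (a != v0) && (par a == b) = (a != v0) && (canon_par k d (rho a) == rho b).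
  have [//|av] := eqVneq a v0; rewrite /= -parE //.
  by rewrite val_eqE (inj_eq perm_inj).
by rewrite !aux.
Qed.

End SLOCanonical.

(** * The Dirichlet form and its Rayleigh quotient *)
Section DirichletForm.
Variables (R : realType) (n : nat).
Notation V := 'I_n.
Implicit Types (e : rel V) (u v w x y : V) (f g h : V -> R).
Local Open Scope ring_scope.

(** The Laplacian on functions on all vertices; on functions vanishing off the interior its interior
    values are those of the Dirichlet operator. *)
Definition lap e f u : R := \sum_v (e u v)%:R * (f u - f v).
Definition dot f g : R := \sum_u f u * g u.
Definition dform e f g : R := dot f (lap e g).
Definition supported e f : Prop := forall v, v \notin interior e -> f v = 0.

(** A variational form of the lowest eigenpair: [f] minimises the Rayleigh quotient, with value [l].
    It is tied to [is_lambda] in [is_lambdaP]. *)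
Definition ground_state e (l : R) f : Prop :=
  [/\ supported e f, 0 < dot f f, dform e f f = l * dot f f &
      forall g, supported e g -> l * dot g g <= dform e g g].

Lemma dot_ge0 f : 0 <= dot f f.
Proof. by apply: sumr_ge0 => u _; rewrite -expr2 sqr_ge0. Qed.

Lemma dot_gt0 f v : f v != 0 -> 0 < dot f f.
Proof.
move=> fv; rewrite /dot (bigD1 v) //=; apply: ltr_pwDl.
  by rewrite -expr2 exprn_even_gt0.
by apply: sumr_ge0 => u _; rewrite -expr2 sqr_ge0.
Qed.

Lemma dot_lin (a : R) f g h : dot (fun u => f u + a * g u) h = dot f h + a * dot g h.
Proof. by rewrite /dot mulr_sumr -big_split; apply: eq_bigr => u _ /=; ring. Qed.

Lemma dotC f g : dot f g = dot g f.
Proof. by apply: eq_bigr => u _; rewrite mulrC. Qed.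

Lemma eq_dot f f' g g' : f =1 f' -> g =1 g' -> dot f g = dot f' g'.
Proof. by move=> ff gg; apply: eq_bigr => u _; rewrite ff gg. Qed.

Lemma eq_lap e f f' : f =1 f' -> lap e f =1 lap e f'.
Proof. by move=> ff u; apply: eq_bigr => v _; rewrite !ff. Qed.

Lemma lap_lin e (a : R) f g u :
  lap e (fun u => f u + a * g u) u = lap e f u + a * lap e g u.
Proof. by rewrite /lap mulr_sumr -big_split; apply: eq_bigr => v _ /=; ring. Qed.

Lemma dform_linl e (a : R) f g h :
  dform e (fun u => f u + a * g u) h = dform e f h + a * dform e g h.
Proof. exact: dot_lin. Qed.

Lemma dform_linr e (a : R) f g h :
  dform e h (fun u => f u + a * g u) = dform e h f + a * dform e h g.
Proof.
rewrite /dform (eq_dot (g' := fun u => lap e f u + a * lap e g u) (frefl _)); last exact: lap_lin.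
by rewrite dotC dot_lin !(dotC h).
Qed.

Lemma dform_sym e f g : simple_graph e -> dform e f g = dform e g f.
Proof.
case=> sym _; rewrite /dform /dot /lap.
under eq_bigr do rewrite mulr_sumr; under [RHS]eq_bigr do rewrite mulr_sumr.
apply/eqP; rewrite -subr_eq0 -sumrB; under eq_bigr do rewrite -sumrB.
have -> : \sum_u \sum_v (f u * ((e u v)%:R * (g u - g v)) - g u * ((e u v)%:R * (f u - f v)))
   = \sum_u \sum_v (e u v)%:R * (g u * f v) - \sum_u \sum_v (e u v)%:R * (f u * g v).
  by rewrite -sumrB; apply: eq_bigr => u _; rewrite -sumrB; apply: eq_bigr => v _; ring.
rewrite subr_eq0; apply/eqP; rewrite exchange_big /=; apply: eq_bigr => u _.
by apply: eq_bigr => v _; rewrite sym; ring.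
Qed.

Lemma supported_lin e (a : R) f g : supported e f -> supported e g ->
  supported e (fun u => f u + a * g u).
Proof. by move=> sf sg v vi; rewrite sf // sg // mulr0 addr0. Qed.

(** First variation: moving from [f] by [t] times [h] changes the nonnegative defect to
    [2 * t * b + t ^+ 2 * c], which forces [b = 0]. *)
Lemma ground_state_eq e l f h : simple_graph e -> ground_state e l f -> supported e h ->
  dform e h f = l * dot h f.
Proof.
move=> sg [sf _ fE fmin] sh.
set b := dform e h f - l * dot h f; set c := dform e h h - l * dot h h.
suff : b = 0 by move/eqP; rewrite subr_eq0 => /eqP.
have c0 : 0 <= c by rewrite subr_ge0 fmin.
have quad t : 0 <= 2 * t * b + t ^+ 2 * c.
  have := fmin _ (supported_lin t sf sh); rewrite -subr_ge0; congr (_ <= _).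
  rewrite dform_linl !dform_linr dot_lin !(dotC _ (fun u => f u + t * h u)) !dot_lin.
  by rewrite (dform_sym f h sg) (dotC f h) /b /c fE; ring.
apply/eqP; apply: contraT => b0.
have b2 : 0 < b ^+ 2 by rewrite exprn_even_gt0.
have c1 : 0 < c + 1 by rewrite ltr_wpDl.
(* Close to the minimiser [- b / c]; the added [1] avoids division by zero. *)
have := quad (- b / (c + 1)).
have -> : 2 * (- b / (c + 1)) * b + (- b / (c + 1)) ^+ 2 * c = - (b ^+ 2 * (c + 2) / (c + 1) ^+ 2).
  by field; rewrite gt_eqF.
rewrite oppr_ge0 leNgt divr_gt0 ?exprn_gt0 // mulr_gt0 //.
by rewrite ltr_wpDl.
Qed.

Lemma ground_state_unique e l l' f f' : ground_state e l f -> ground_state e l' f' -> l = l'.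
Proof.
move=> [sf f0 fE fmin] [sf' f0' fE' fmin']; apply/eqP; rewrite eq_le.
have := fmin _ sf'; rewrite fE' ler_pM2r // => ->.
by have := fmin' _ sf; rewrite fE ler_pM2r.
Qed.

Lemma ground_state_lap e l f v : simple_graph e -> ground_state e l f ->
  v \in interior e -> lap e f v = l * f v.
Proof.
move=> sg gs vi.
have dE g : dot (fun u => (u == v)%:R) g = g v.
  rewrite /dot (bigD1 v) //= eqxx mul1r big1 ?addr0 // => u /negPf->; exact: mul0r.
have := ground_state_eq (h := fun u => (u == v)%:R) sg gs; rewrite /dform !dE; apply.
by move=> u; apply: contraNeq; rewrite pnatr_eq0 eqb0 negbK => /eqP->.
Qed.

(** Absolute values keep the norm and increase no term of the form, so minimality forces
    equality. *)
Lemma ground_state_abs e l f : ground_state e l f -> ground_state e l (fun u => `|f u|).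
Proof.
move=> [sf f0 fE fmin].
have dE : dot (fun u => `|f u|) (fun u => `|f u|) = dot f f.
  by apply: eq_bigr => u _; rewrite -!expr2 real_normK ?num_real.
have sa : supported e (fun u => `|f u|) by move=> v vi; rewrite sf // normr0.
split; rewrite ?dE //; apply/eqP; rewrite eq_le -{2}dE fmin // andbT -fE.
rewrite /dform /dot /lap; apply: ler_sum => u _; rewrite !mulr_sumr; apply: ler_sum => v _.
case: (e u v); rewrite ?mul0r ?mulr0 // !mul1r !mulrBr -!expr2 real_normK ?num_real //.
by rewrite lerB // -normrM ler_norm.
Qed.

(* An interior zero of a nonnegative ground state spreads to all its neighbours, hence
   down the tree rooted at it. *)
Lemma ground_state_pos e l f : is_tree e -> ground_state e l f -> (forall v, 0 <= f v) ->
  forall v, v \in interior e -> 0 < f v.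
Proof.
move=> tr gs f0 v vi; have [sg conn _] := tr; have [sf fgt0 _ _] := gs.
rewrite lt_neqAle f0 andbT eq_sym; apply/eqP => fv.
have [par [[hpar eE] _]] := tree_rooted v tr.
have pin := rooted_par_interior (conj hpar eE) vi.
have lapz u : u \in interior e -> f u = 0 -> forall w, e u w -> f w = 0.
  move=> ui fu w euw; have := ground_state_lap sg gs ui.
  rewrite fu mulr0 /lap => /eqP.
  under eq_bigr do rewrite fu sub0r mulrN; rewrite sumrN oppr_eq0 psumr_eq0; last first.
    by move=> x _; rewrite mulr_ge0.
  by move/allP/(_ w); rewrite mem_index_enum euw mul1r => /(_ isT)/eqP.
have all0 w : f w = 0.
  move: {2}(height e v w) (leqnn (height e v w)) => m; elim: m w => [|m IH] w hw.
    by have [->//|/hpar] := eqVneq w v; case: (height e v w) hw.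
  have [->//|wv] := eqVneq w v.
  apply: (lapz (par w)); [exact: pin | apply: IH; have := hpar w wv; lia |].
  by rewrite eE wv eqxx.
by move: fgt0; rewrite /dot big1 ?ltxx // => u _; rewrite all0 mul0r.
Qed.

(** * The smallest Dirichlet eigenvalue *)
Section Ext.
Variable e : rel V.

Definition ext_row (v : 'rV[R]_#|interior e|) : V -> R :=
  fun x => \sum_i v ord0 i * (enum_val i == x)%:R.

Lemma ext_rowE (v : 'rV_#|interior e|) i : ext_row v (enum_val i) = v ord0 i.
Proof.
rewrite /ext_row (bigD1 i) //= eqxx mulr1 big1 ?addr0 // => j ji.
by rewrite (inj_eq enum_val_inj) (negPf ji) mulr0.
Qed.

Lemma ext_row_supported (v : 'rV_#|interior e|) : supported e (ext_row v).
Proof.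
move=> x xi; apply: big1 => i _; case: eqP => [xE|]; last by rewrite mulr0.
by move: xi; rewrite -xE enum_valP.
Qed.

Lemma sum_interior f : supported e f -> \sum_x f x = \sum_i f (@enum_val _ (mem (interior e)) i).
Proof.
move=> sf; rewrite -(big_enum_val (fun x => f x)) /= [LHS](bigID [in interior e]) /=.
by rewrite [X in _ + X]big1 ?addr0.
Qed.

Lemma ext_row_restr f : supported e f -> ext_row (\row_i f (enum_val i)) =1 f.
Proof.
move=> sf x; have [xi|xi] := boolP (x \in interior e); last by rewrite ext_row_supported ?sf.
by rewrite -(enum_rankK_in xi xi) ext_rowE mxE.
Qed.

Hypothesis sg : simple_graph e.

Lemma mul_dirichlet (v : 'rV_#|interior e|) j :
  (v *m dirichlet R e) ord0 j = lap e (ext_row v) (enum_val j).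
Proof.
have [sym irr] := sg; set y := enum_val j.
rewrite mxE; transitivity (\sum_x ext_row v x * laplacian R e x y).
  rewrite (sum_interior (f := fun x => ext_row v x * laplacian R e x y)); last first.
    by move=> x /(ext_row_supported v)->; rewrite mul0r.
  by apply: eq_bigr => i _; rewrite ext_rowE mxE.
rewrite (bigD1 y) //= mxE eqxx /lap [RHS](bigD1 y) //= (negPf (irr y)) mul0r add0r.
rewrite deg_sum natr_sum (bigD1 y) //= (negPf (irr y)) add0r mulr_sumr -big_split /=.
apply: eq_bigr => x xy; rewrite mxE (negPf xy) (sym x).
by case: (e y x); rewrite /=; ring.
Qed.

Lemma eigenvalue_ge l f m : ground_state e l f -> eigenvalue (dirichlet R e) m -> l <= m.
Proof.
move=> [sf _ _ fmin] /eigenvalueP[v vE v0].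
have [i vi] : exists i, v ord0 i != 0.
  apply/existsP; apply: contraT; rewrite negb_exists => /forallP vz; move: v0.
  apply: contraNT => _; apply/eqP/rowP => i; rewrite mxE; apply/eqP.
  by have := vz i; rewrite negbK.
have gt : 0 < dot (ext_row v) (ext_row v).
  by apply: (@dot_gt0 _ (enum_val i)); rewrite ext_rowE.
rewrite -(ler_pM2r gt); apply: le_trans (fmin _ (ext_row_supported v)) _.
rewrite /dform /dot mulr_sumr le_eqVlt; apply/orP; left; apply/eqP; apply: eq_bigr => x _.
have [xi|xi] := boolP (x \in interior e); last by rewrite ext_row_supported // !mul0r mulr0.
by rewrite -(enum_rankK_in xi xi) -mul_dirichlet vE !mxE ext_rowE; ring.
Qed.

Lemma eigenvalue_ground l f : ground_state e l f -> eigenvalue (dirichlet R e) l.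
Proof.
move=> gs; have [sf fgt0 _ _] := gs.
apply/eigenvalueP; exists (\row_i f (enum_val i)).
  apply/rowP => j; rewrite mul_dirichlet !mxE (eq_lap _ (ext_row_restr sf)).
  by rewrite (ground_state_lap sg gs) ?enum_valP.
apply: contraTneq fgt0 => /rowP z; rewrite /dot big1 ?ltxx // => x _.
have [xi|xi] := boolP (x \in interior e); last by rewrite sf ?mul0r.
by have := z (enum_rank_in xi x); rewrite !mxE (enum_rankK_in xi xi) => ->; rewrite mul0r.
Qed.

(** Coordinates minimising the form on the unit sphere give [f]; any other nonzero function is
    scaled to the sphere. *)
Lemma ground_state_exists : interior e != set0 -> exists l f, ground_state e l f.
Proof.
move=> i0; have m0 : (0 < #|interior e|)%N by rewrite card_gt0.
pose Q (i j : 'I_#|interior e|) := dirichlet R e i j.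
have [v v1 vmin] := quadratic_sphere_min Q m0.
have dotE (w : 'rV_#|interior e|) : dot (ext_row w) (ext_row w) = \sum_i w ord0 i ^+ 2.
  rewrite /dot sum_interior => [|x /(ext_row_supported w)->]; last by rewrite mul0r.
  by apply: eq_bigr => i _; rewrite ext_rowE expr2.
have formE (w : 'rV_#|interior e|) : dform e (ext_row w) (ext_row w) = \sum_i \sum_j w ord0 i * w ord0 j * Q i j.
  rewrite /dform /dot sum_interior => [|x /(ext_row_supported w)->]; last by rewrite mul0r.
  rewrite exchange_big; apply: eq_bigr => j _ /=; rewrite -mul_dirichlet ext_rowE mxE mulr_sumr.
  by apply: eq_bigr => i _; rewrite /Q; ring.
exists (dform e (ext_row v) (ext_row v)), (ext_row v).
have v1' : dot (ext_row v) (ext_row v) = 1 by rewrite dotE.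
split; rewrite ?v1' ?mulr1 //; first exact: ext_row_supported.
move=> g sgp; pose w : 'rV_#|interior e| := \row_i g (enum_val i).
have wE : ext_row w =1 g := ext_row_restr sgp.
have -> : dot g g = dot (ext_row w) (ext_row w) by apply: eq_dot => x; rewrite wE.
have -> : dform e g g = dform e (ext_row w) (ext_row w).
  by apply: eq_dot => [x|]; [rewrite wE | apply: eq_lap => x; rewrite wE].
have [z|nz] := eqVneq (dot (ext_row w) (ext_row w)) 0.
  rewrite z mulr0 le_eqVlt; apply/orP; left; rewrite eq_sym; apply/eqP; apply: big1 => x _.
  have [->|/dot_gt0] := eqVneq (ext_row w x) 0; first exact: mul0r.
  by rewrite z ltxx.
have N0 : 0 < dot (ext_row w) (ext_row w) by rewrite lt_neqAle eq_sym nz dot_ge0.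
set N := dot _ _ in N0 *; pose s := Num.sqrt N.
have s2 : s ^+ 2 = N by rewrite sqr_sqrtr // ltW.
have s0 : s != 0 by rewrite -sqrf_eq0 s2 gt_eqF.
have u1 : \sum_i (s^-1 *: w) ord0 i ^+ 2 = 1.
  under eq_bigr do rewrite mxE exprMn; rewrite -mulr_sumr -dotE -/N exprVn s2 mulVf //.
have := vmin _ u1; rewrite -formE -(ler_pM2r N0) => /le_trans; apply.
rewrite formE mulr_suml le_eqVlt; apply/orP; left; apply/eqP; apply: eq_bigr => i _.
rewrite mulr_suml; apply: eq_bigr => j _; rewrite -s2 ![(s^-1 *: w) _ _]mxE; field.
exact: s0.
Qed.

End Ext.

Lemma is_lambdaP e (l : R) : simple_graph e -> interior e != set0 ->
  is_lambda e l <-> exists f, ground_state e l f.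
Proof.
move=> sg i0; split=> [[ev lmin]|[f gs]]; last first.
  by split=> [|m]; [exact: eigenvalue_ground gs | exact: eigenvalue_ge gs].
have [l' [f gs]] := ground_state_exists sg i0.
exists f; suff -> : l = l' by [].
apply/eqP; rewrite eq_le lmin; last exact: eigenvalue_ground gs.
exact: eigenvalue_ge gs ev.
Qed.

Lemma positive_ground_state e : tree_with_boundary e ->
  exists l f, ground_state e l f /\ forall v, (0 < f v) = (v \in interior e).
Proof.
case=> tr _ _ i0; have [sg _ _] := tr.
have [l [f /ground_state_abs gs]] := ground_state_exists sg i0.
exists l, (fun u => `|f u|); split=> // v; apply/idP/idP.
  by apply: contraLR; case: gs => sf _ _ _ /sf->; rewrite ltxx.
by apply: (ground_state_pos tr gs).
Qed.

End DirichletForm.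

(** * Layer-cake comparison with the canonical tree *)
Section LayerCake.
Variables (R : realType) (n : nat).
Notation V := 'I_n.
Implicit Types (e : rel V) (u v w x y : V) (f g h : V -> R) (A B C : {set V}).
Local Open Scope ring_scope.

Definition ind A : V -> R := fun v => (v \in A)%:R.

(** At [u] in [C], hence in [A], [lap] of the indicator of [A] counts the neighbours outside [A]. *)
Lemma dform_ind e A C : C \subset A -> dform e (ind C) (ind A) = (edges e C (~: A))%:R.
Proof.
move/subsetP => sCA; rewrite /dform /dot /edges natr_sum [RHS]big_mkcond.
apply: eq_bigr => u _; rewrite /ind; case: ifP => uC; last by rewrite mul0r.
rewrite mul1r /lap natr_sum [RHS]big_mkcond; apply: eq_bigr => v _.
by rewrite (sCA u uC) inE; case: (v \in A); rewrite /= ?subrr ?subr0 ?mulr0 ?mulr1.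
Qed.

Lemma dform_sumr e (m : nat) (a : 'I_m -> R) (F : 'I_m -> V -> R) g h :
  (forall v, g v = \sum_c a c * F c v) -> dform e h g = \sum_c a c * dform e h (F c).
Proof.
move=> gE; rewrite /dform /dot.
transitivity (\sum_u \sum_c h u * (a c * lap e (F c) u)).
  apply: eq_bigr => u _; rewrite -mulr_sumr; congr (_ * _); rewrite /lap.
  under [RHS]eq_bigr do rewrite mulr_sumr; rewrite [RHS]exchange_big; apply: eq_bigr => v _ /=.
  by rewrite !gE -sumrB mulr_sumr; apply: eq_bigr => c _; ring.
rewrite exchange_big; apply: eq_bigr => c _ /=; rewrite mulr_sumr.
by apply: eq_bigr => u _; ring.
Qed.

Lemma dform_relabel e (s : {perm V}) f g :
  dform (fun i j => e (s i) (s j)) (f \o s) (g \o s) = dform e f g.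
Proof.
rewrite /dform /dot [RHS](reindex_inj (@perm_inj _ s)); apply: eq_bigr => u _ /=.
by rewrite /lap [in RHS](reindex_inj (@perm_inj _ s)).
Qed.

Lemma dot_relabel (s : {perm V}) f g : dot (f \o s) (g \o s) = dot f g.
Proof. by rewrite /dot [RHS](reindex_inj (@perm_inj _ s)). Qed.

Lemma ground_state_relabel e e' (s : {perm V}) l f :
  (forall x y, e x y = e' (s x) (s y)) -> ground_state e' l f -> ground_state e l (f \o s).
Proof.
move=> eE [sf f0 fE fmin].
have dE : forall g h, dform e (g \o s) (h \o s) = dform e' g h.
  move=> g h; rewrite -(dform_relabel e' s); apply: eq_dot => // u.
  by apply: eq_bigr => v _; rewrite eE.
have iE v : (v \in interior e) = (s v \in interior e').
  rewrite !inE !deg_sum; congr (1 < _)%N.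
  by rewrite [RHS](reindex_inj (@perm_inj _ s)); apply: eq_bigr => w _; rewrite eE.
split.
- by move=> v; rewrite iE => /sf.
- by rewrite dot_relabel.
- by rewrite dE dot_relabel.
move=> g sgr; pose g' := g \o s^-1%g.
have gE : g =1 g' \o s by move=> x; rewrite /g' /= permK.
rewrite (eq_dot gE gE) dot_relabel.
have -> : dform e g g = dform e (g' \o s) (g' \o s) by apply: eq_dot => //; apply: eq_lap.
by rewrite dE; apply: fmin => v vi; apply: sgr; rewrite iE permKV.
Qed.

Lemma is_lambda_iso e e' (s : {perm V}) (l : R) : simple_graph e -> interior e != set0 ->
  simple_graph e' -> interior e' != set0 ->
  (forall x y, e x y = e' (s x) (s y)) -> is_lambda e' l -> is_lambda e l.
Proof.
move=> sg i0 sg' i0' eE /is_lambdaP-/(_ sg' i0')[f gs].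
by apply/is_lambdaP => //; exists (f \o s); apply: ground_state_relabel gs.
Qed.

(** [C] and its complement are sorted separately and concatenated, so [C] becomes an initial segment
    even if [f] ties across its border. *)
Lemma sorting_perm f C : (forall u v, u \in C -> v \notin C -> f v <= f u) ->
  exists s : {perm V}, (forall i j : V, (i <= j)%N -> f (s j) <= f (s i)) /\
    forall i, (s i \in C) = (i < #|C|)%N.
Proof.
move=> fC; pose leT : rel V := fun u v => f v <= f u.
have tot : total leT by move=> u v; apply: le_total.
have tr : transitive leT by move=> v u w uv vw; apply: le_trans vw uv.
pose p1 := sort leT (enum C); pose p2 := sort leT (enum (~: C)).
have mem1 v : (v \in p1) = (v \in C) by rewrite mem_sort mem_enum.
have mem2 v : (v \in p2) = (v \notin C) by rewrite mem_sort mem_enum inE.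
have sz1 : size p1 = #|C| by rewrite size_sort -cardE.
have sz : size (p1 ++ p2) == n.
  by rewrite size_cat !size_sort -!cardE cardsC card_ord.
have uq : uniq (p1 ++ p2).
  rewrite cat_uniq !sort_uniq !enum_uniq /= andbT.
  by apply/hasPn => v; rewrite !mem_sort !mem_enum inE.
have srt : sorted leT (p1 ++ p2).
  rewrite sorted_pairwise // pairwise_cat -!sorted_pairwise // !sort_sorted // !andbT.
  by apply/allrelP => u v; rewrite mem1 mem2; apply: fC.
pose t := Tuple sz.
have tinj : injective (tnth t) by apply/tuple_uniqP.
exists (perm tinj); split=> [i j ij|i].
  rewrite !permE !(tnth_nth i); have := sorted_leq_nth tr _ i srt.
  by apply; rewrite ?inE ?(eqP sz) //; move=> u; exact: lexx.
rewrite permE (tnth_nth i) /= nth_cat sz1; case: ltnP => iC.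
  by rewrite -mem1 mem_nth ?sz1.
apply/negbTE; rewrite -mem2 mem_nth // -(ltn_add2l #|C|) subnKC //.
by rewrite -sz1 -size_cat (eqP sz).
Qed.

Section Comparison.
Variables (k d : nat) (e : rel V) (s : {perm V}) (f : V -> R).
Hypotheses (k_gt0 : (0 < k)%N) (k_lt : (k < n)%N) (d_ge2 : (2 <= d)%N) (cl : in_class k d e).
Hypothesis sint : forall i, (s i \in interior e) = (i < k)%N.
Hypothesis smon : forall i j : V, (i <= j)%N -> f (s j) <= f (s i).
Hypothesis fsup : supported e f.

Let T : rel V := @canon n k d.
Let E : rel V := fun i j => e (s i) (s j).
Let g : V -> R := f \o s.
Let size_ok : (d.-1 * k + 2 <= n)%N := class_size d_ge2 cl.
Let clT : in_class k d T := canon_in_class k_gt0 k_lt d_ge2 size_ok.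

Let sgE : simple_graph E.
Proof. by have [[[[sym irr] _ _] _ _ _] _ _] := cl; split=> x *; rewrite /E. Qed.

Let sgT : simple_graph T.
Proof. by have [[[]]] := clT. Qed.

Lemma edges_relabel A B : edges E A B = edges e (s @: A) (s @: B).
Proof.
have inj : injective s := @perm_inj _ s.
rewrite /edges big_imset /=; last by move=> x y _ _; apply: inj.
by apply: eq_bigr => u _; rewrite big_imset //; move=> x y _ _; apply: inj.
Qed.

Lemma imset_permC A : ~: (s @: A) = s @: (~: A).
Proof.
apply/setP => v; rewrite -[v](permKV s) inE !mem_imset ?inE //; exact: perm_inj.
Qed.

(** For [c < k] the canonical count is the lower bound of [edges_out_ge]; for [c = k] both sides are
    [n - k]. *)
Lemma canon_edges_le c b : (0 < c)%N -> (c <= b <= k)%N ->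
  (edges T (ord_prefix n c) (~: ord_prefix n b) <= edges E (ord_prefix n c) (~: ord_prefix n b))%N.
Proof.
move=> c0 cbk; rewrite edges_relabel -imset_permC.
have [tbe ik _] := cl; have [tbT ikT _] := clT.
have card_pre m : (m <= k)%N -> #|s @: ord_prefix n m| = m.
  by move=> mk; rewrite card_imset ?card_ord_prefix //; [lia | apply: perm_inj].
have sub_pre m : (m <= k)%N -> s @: ord_prefix n m \subset interior e.
  move=> mk; apply/subsetP => _ /imsetP[i + ->]; rewrite inE sint => im.
  exact: leq_trans mk.
have [ck|ck] := ltnP c k.
  rewrite canon_edges_out ?c0 //; have := @edges_out_ge n k d e (s @: ord_prefix n b) (s @: ord_prefix n c).
  rewrite !card_pre; [| lia | lia]; apply=> //; last by apply: sub_pre; lia.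
    by rewrite -card_gt0 card_pre //; lia.
  by apply: imsetS; apply/subsetP => i; rewrite !inE; lia.
have [-> ->] : c = k /\ b = k by lia.
have <- : interior e = s @: ord_prefix n k.
  apply/eqP; rewrite eq_sym eqEcard sub_pre //= card_pre // ik //.
have -> : ord_prefix n k = interior T by rewrite canon_interior.
by rewrite !interior_boundary_edges // ik ikT.
Qed.

Let qf (e' : rel V) (c b : nat) : R := dform e' (ind (ord_prefix n c)) (ind (ord_prefix n b)).

Let qf_le c b : (0 < c <= k)%N -> (0 < b <= k)%N -> qf T c b <= qf E c b.
Proof.
wlog cb : c b / (c <= b)%N => [hw|] hc hb.
  have [cb|/ltnW bc] := leqP c b; first exact: hw.
  by rewrite /qf dform_sym // [X in _ <= X]dform_sym //; apply: hw.
have sub : ord_prefix n c \subset ord_prefix n b by apply/subsetP => i; rewrite !inE; lia.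
by rewrite /qf !dform_ind // ler_nat canon_edges_le //; lia.
Qed.

(** [g] on natural numbers, so that [jump] can name position [c.+1]; as [c < k < n], the default [0]
    is not reached there. *)
Let G (c : nat) : R := oapp g 0 (insub c).
Let jump (c : 'I_k) : R := G c - G c.+1.

Let GE (i : V) : G i = g i.
Proof. by rewrite /G valK. Qed.

Let jumpE (i j : V) (ik : (i < k)%N) : j = i.+1 :> nat -> jump (Ordinal ik) = g i - g j.
Proof. by move=> ji; rewrite /jump /= -ji !GE. Qed.

Let jump_ge0 c : 0 <= jump c.
Proof.
have h1 : (c < n)%N by apply: ltn_trans k_lt.
have h2 : (c.+1 < n)%N by apply: leq_ltn_trans k_lt.
rewrite /jump -[c : nat]/(Ordinal h1 : nat) -[(Ordinal h1).+1]/(Ordinal h2 : nat).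
by rewrite !GE subr_ge0; apply: smon => /=.
Qed.

(** The jumps from [v] on telescope to [g v], because position [k] holds a boundary vertex, of value
    [0]. *)
Let layers v : g v = \sum_(c < k) jump c * ind (ord_prefix n c.+1) v.
Proof.
rewrite (eq_bigr (fun c : 'I_k => if (v <= c)%N then G c - G c.+1 else 0)); last first.
  by move=> c _; rewrite /ind inE ltnS; case: leqP; rewrite ?mulr1 ?mulr0.
rewrite -big_mkcond /=.
have Gk : G k = 0.
  by rewrite -[k]/(Ordinal k_lt : nat) GE /g /= fsup // sint /= ltnn.
have [vk|vk] := ltnP v k; last first.
  rewrite big_pred0 => [|c]; first by rewrite /g /= fsup // sint -leqNgt.
  by apply/negbTE; rewrite -ltnNge; apply: leq_trans vk.
rewrite -(big_mkord (fun c => v <= c)%N (fun c => G c - G c.+1)).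
rewrite (big_cat_nat (n := v)) //=; last exact: ltnW.
rewrite big_nat_cond big_pred0 => [|c]; last by rewrite ltnNge; case: (v <= c)%N; rewrite ?andbF.
rewrite add0r big_nat_cond (eq_bigl (fun c => (v <= c < k)%N)) => [|c]; last first.
  by case: (v <= c)%N; rewrite ?andbT.
rewrite -big_nat (telescope_sumr_eq (fun c => - G c)); [|exact: ltnW|]; last first.
  by move=> c _; ring.
by rewrite Gk GE; ring.
Qed.

Let form_ind e' c : dform e' (ind (ord_prefix n c)) g = \sum_(b < k) jump b * qf e' c b.+1.
Proof. exact: dform_sumr layers. Qed.

Let form_layers e' : simple_graph e' ->
  dform e' g g = \sum_(c < k) jump c * \sum_(b < k) jump b * qf e' c.+1 b.+1.
Proof.
move=> sg'; rewrite (dform_sumr _ _ layers); apply: eq_bigr => c _.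
by rewrite dform_sym // form_ind.
Qed.

(** Both forms expand over the same layers with nonnegative coefficients, so [qf_le] applies
    termwise. *)
Lemma canon_dform_le : dform T g g <= dform e f f.
Proof.
rewrite -(dform_relabel e s) !form_layers //.
apply: ler_sum => c _; rewrite ler_wpM2l //; apply: ler_sum => b _.
by rewrite ler_wpM2l // qf_le // ltn0Sn /= ltn_ord.
Qed.

Lemma sorted_supported : supported T g.
Proof.
by move=> v; rewrite canon_interior // inE => vk; rewrite /g /= fsup // sint.
Qed.

(* Testing the two eigenvector equations against the indicator of an initial segment and
   subtracting leaves a vanishing sum of nonnegative terms. *)
Lemma canon_edges_eq l : ground_state e l f ->
  (forall h, supported T h -> l * dot h h <= dform T h h) ->
  forall (c : nat) (i j : V), (0 < c <= k)%N -> (i < k)%N -> j = i.+1 :> nat -> f (s j) < f (s i) ->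
  edges e (s @: ord_prefix n (minn c j)) (~: (s @: ord_prefix n (maxn c j))) =
  edges T (ord_prefix n (minn c j)) (~: ord_prefix n (maxn c j)).
Proof.
move=> gs Tmin c i j ck ik jE fji; have [_ f0 fE _] := gs.
have gsE : ground_state E l g by apply: ground_state_relabel gs.
(* The form of [g] on [T] is at most [l * dot g g] by comparison and at least that by [Tmin], so [g]
   is a ground state of both trees. *)
have gsT : ground_state T l g.
  have dE : dot g g = dot f f by apply: dot_relabel.
  split; rewrite ?dE //; first exact: sorted_supported.
  apply/eqP; rewrite eq_le -{1}fE canon_dform_le -dE Tmin //; exact: sorted_supported.
have supT : supported T (ind (ord_prefix n c)).
  move=> v; rewrite canon_interior // /ind !inE => vk; case: ltnP => // vc.
  by case/negP: vk; lia.
have supE : supported E (ind (ord_prefix n c)).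
  move=> v; have -> : (v \in interior E) = (s v \in interior e).
    rewrite !inE !deg_sum; congr (1 < _)%N.
    by rewrite [RHS](reindex_inj (@perm_inj _ s)).
  rewrite sint => vk; rewrite /ind inE; case: ltnP => // vc.
  by case/negP: vk; lia.
have := ground_state_eq sgE gsE supE; rewrite -(ground_state_eq sgT gsT supT).
rewrite !form_ind => /eqP; rewrite -subr_eq0 -sumrB psumr_eq0 => [/allP|b _]; last first.
  by rewrite -mulrBr mulr_ge0 // subr_ge0 qf_le // ltn0Sn /= ltn_ord.
move/(_ (Ordinal ik)); rewrite mem_index_enum => /(_ isT).
rewrite -mulrBr (jumpE _ jE) mulf_eq0 !subr_eq0 /= [_ == _]gt_eqF //= -jE.
rewrite /qf; have [cj|jc] := leqP c j.
  have sub : ord_prefix n c \subset ord_prefix n j by apply/subsetP => v; rewrite !inE; lia.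
  by rewrite !dform_ind // eqr_nat edges_relabel -imset_permC => /eqP.
have sub : ord_prefix n j \subset ord_prefix n c by apply/subsetP => v; rewrite !inE; lia.
rewrite dform_sym // [X in _ == X]dform_sym // !dform_ind // eqr_nat.
by rewrite edges_relabel -imset_permC => /eqP.
Qed.

End Comparison.
End LayerCake.

(** * Refining a vertex weight to a spiral-like order *)
Section ParentOrder.
Variables (R : realType) (n : nat).
Notation V := 'I_n.
Variables (x0 : V) (par : V -> V) (h : V -> nat) (f : V -> R).
Hypothesis hpar : forall v, v != x0 -> h (par v) < h v.
Implicit Types (u v w : V) (r : V -> nat).

Definition weight_rank v : nat := #|[set w | (f v < f w)%R]|.

Lemma weight_rank_lt u v : (weight_rank u < weight_rank v) = (f v < f u)%R.
Proof.
have le a b : (f b <= f a)%R -> weight_rank a <= weight_rank b.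
  move=> ab; apply/subset_leq_card/subsetP => w; rewrite !inE; exact: le_lt_trans.
have [fuv|fvu] := leP (f u) (f v); first by rewrite ltnNge le.
apply: proper_card; apply/properP; split.
  by apply/subsetP => w; rewrite !inE; apply: lt_trans.
by exists u; rewrite inE ?ltxx.
Qed.

(** The first key puts [x0] first even among equal weights; the last makes the order total. *)
Definition lex_order r : rel V := fun u v =>
  ((u != x0) < (v != x0)) || ((u != x0) == (v != x0)) &&
  ((weight_rank u < weight_rank v) || (weight_rank u == weight_rank v) &&
  ((r (par u) < r (par v)) || (r (par u) == r (par v)) && (u < v))).

Lemma lex_order_strict r : strict_total_order (lex_order r).
Proof.
split=> [x|x y z|x y]; rewrite /lex_order; first by lia.
  case: (x != x0); case: (y != x0); case: (z != x0); lia.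
rewrite -val_eqE; case: (x != x0); case: (y != x0) => /=; lia.
Qed.

(** Breaking ties by the order of the parents refers to the order being defined; iterating from the
    vertex numbers resolves the circularity. *)
Fixpoint parent_rank m : V -> nat :=
  if m is m'.+1 then rank_of (lex_order (parent_rank m')) else val.

Let P m := lex_order (parent_rank m).

Let P_succ m u v : P m.+1 u v =
  ((u != x0) < (v != x0)) || ((u != x0) == (v != x0)) &&
  ((weight_rank u < weight_rank v) || (weight_rank u == weight_rank v) &&
  (P m (par u) (par v) || (par u == par v) && (u < v))).
Proof.
have st := lex_order_strict (parent_rank m).
by rewrite /P /lex_order /= rank_of_lt // rank_of_eq.
Qed.

(** Each round hands a tie to the parents, where [h] is smaller; once one side is [x0], the first
    key decides. *)
Lemma parent_rank_stable m u v : minn (h u) (h v) <= m -> P m.+1 u v = P m u v.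
Proof.
have irr j x : P j x x = false by have [/(_ x)/negPf] := lex_order_strict (parent_rank j).
have dec j w : w != x0 -> P j x0 w /\ P j w x0 = false.
  by rewrite /P /lex_order eqxx => ->.
elim: m u v => [|m IH] u v hm; have [->|uv] := eqVneq u v; rewrite ?irr //.
  have [ux|ux] := eqVneq u x0.
    by have vx : v != x0 by [rewrite -ux eq_sym]; rewrite ux !(dec _ v vx).1.
  have [vx|vx] := eqVneq v x0; first by rewrite vx !(dec _ u ux).2.
  by have := hpar ux; have := hpar vx; lia.
have [ux|ux] := eqVneq u x0.
  by have vx : v != x0 by [rewrite -ux eq_sym]; rewrite ux !(dec _ v vx).1.
have [vx|vx] := eqVneq v x0; first by rewrite vx !(dec _ u ux).2.
by rewrite P_succ [in RHS]P_succ IH //; have := hpar ux; have := hpar vx; lia.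
Qed.

Lemma parent_order_exists : (forall v, (f v <= f x0)%R) ->
  exists prec : rel V, [/\ strict_total_order prec,
    forall v, ~~ prec v x0,
    forall u v, prec u v -> (f v <= f u)%R,
    forall u v, v != x0 -> (f v < f u)%R -> prec u v &
    forall u v, u != x0 -> v != x0 -> f u = f v -> prec (par u) (par v) -> prec u v].
Proof.
(* [N] bounds all heights, so a further round leaves [P N] unchanged: its ties are broken by
   itself. *)
move=> fmax; pose N := \max_v h v; exists (P N).
have hN v : h v <= N by apply: leq_bigmax.
have wr u v : f u = f v -> weight_rank u = weight_rank v.
  by rewrite /weight_rank => ->.
have st := lex_order_strict (parent_rank N); have [irr _ _] := st.
split=> //.
- move=> v; have [->//|vx] := eqVneq v x0; first exact: irr.
  by rewrite /P /lex_order eqxx vx.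
- move=> u v; have [->|ux] := eqVneq u x0; first by rewrite fmax.
  rewrite /P /lex_order ux; case: (v != x0) => //=.
  by rewrite leNgt -weight_rank_lt; lia.
- move=> u v vx fvu; rewrite /P /lex_order vx weight_rank_lt fvu /=.
  by case: (u != x0).
- move=> u v ux vx fE pp; rewrite -parent_rank_stable; last by rewrite geq_min hN.
  by rewrite P_succ ux vx (wr _ _ fE) pp !eqxx orbT.
Qed.

End ParentOrder.

(** * The equality case *)
(* Elaboration leaves [{set 'I_n}] cardinals in several convertible forms, which
   [lia] would take for different atoms. *)
Ltac card_lia := simpl in *; lia.

Section EqualityCase.
Variables (R : realType) (n k d : nat) (e : rel 'I_n) (l : R) (f : 'I_n -> R).
Notation V := 'I_n.
Hypotheses (k_gt0 : 0 < k) (k_lt : k < n) (d_ge2 : 2 <= d) (cl : in_class k d e).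
Hypothesis gs : ground_state e l f.
Hypothesis f_gt0 : forall v, (0 < f v)%R = (v \in interior e).
Hypothesis canon_min : forall g : V -> R, supported (@canon n k d) g ->
  (l * dot g g <= dform (@canon n k d) g g)%R.
Implicit Types (u v w x y : V) (A B C : {set V}).

Let size_ok : d.-1 * k + 2 <= n := class_size d_ge2 cl.

Let f_boundary v : v \notin interior e -> f v = 0%R.
Proof. by case: gs => sf _ _ _ /sf. Qed.

Let f_ge0 v : (0 <= f v)%R.
Proof.
have [vi|/f_boundary->//] := boolP (v \in interior e).
by rewrite ltW // f_gt0.
Qed.

Lemma imset_segment (s : {perm V}) C c : (forall i, (s i \in C) = (i < c)) ->
  s @: ord_prefix n c = C.
Proof.
move=> sC; apply/setP => v; rewrite -[v](permKV s) mem_imset ?inE ?sC //.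
exact: perm_inj.
Qed.

(** [sorting_perm] makes [C] an initial segment. [A], strictly heavier than its complement, is one
    in every sorted order, and the weight drops at its end, as [canon_edges_eq] requires. Only [C]
    may cut through a level. *)
Lemma extremal_edges A C : C != set0 -> A != set0 ->
  C \subset interior e -> A \subset interior e ->
  (forall u v, u \in C -> v \notin C -> (f v <= f u)%R) ->
  (forall u v, u \in A -> v \notin A -> (f v < f u)%R) ->
  (C \subset A -> #|C| < k -> edges e C (~: A) = d.-1 * #|C| + 2 - #|A|) /\
  (A \subset C -> #|A| < k -> edges e A (~: C) = d.-1 * #|A| + 2 - #|C|).
Proof.
move=> C0 A0 sC sA upC upA; have [_ ik _] := cl.
have [s [smon sCE]] := sorting_perm upC.
have seg (B : {set V}) : (forall u v, u \in B -> v \notin B -> (f v < f u)%R) ->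
    forall i, (s i \in B) = (i < #|B|).
  move=> upB i; rewrite (@imset_perm_downset _ s^-1%g) ?permK // => u v uv vB.
  apply: contraT => /(upB _ _ vB); rewrite ltNge.
  by have := smon _ _ (ltnW uv); rewrite !permKV => ->.
have sAE := seg A upA.
have sint i : (s i \in interior e) = (i < k).
  rewrite -ik; apply: seg => u v; rewrite -!f_gt0 -leNgt => fu fv.
  exact: le_lt_trans fu.
have cC : 0 < #|C| <= k by rewrite card_gt0 C0 -ik subset_leq_card.
have cA : 0 < #|A| <= k by rewrite card_gt0 A0 -ik subset_leq_card.
have /andP[a0 ak] := cA; have /andP[c0 _] := cC.
have jN : #|A| < n := leq_ltn_trans ak k_lt.
have iN : #|A|.-1 < n := leq_ltn_trans (leq_pred _) jN.
have fsup : supported e f.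
  by case: gs.
have ik' : Ordinal iN < k by rewrite /= prednK.
have jE : Ordinal jN = (Ordinal iN).+1 :> nat by rewrite /= prednK.
have fji : (f (s (Ordinal jN)) < f (s (Ordinal iN)))%R.
  by apply: upA; rewrite sAE /= ?prednK // ltnn.
have := canon_edges_eq k_gt0 k_lt d_ge2 cl sint smon fsup gs canon_min cC ik' jE fji.
rewrite /= => eqn; split=> [CA ck|AC ak'].
  have le := subset_leq_card CA.
  move: eqn; rewrite (minn_idPl le) (maxn_idPr le) (imset_segment sCE) (imset_segment sAE) => ->.
  by rewrite canon_edges_out // ?c0 // le ak.
have le := subset_leq_card AC.
move: eqn; rewrite (minn_idPr le) (maxn_idPl le) (imset_segment sCE) (imset_segment sAE) => ->.
by rewrite canon_edges_out // ?a0 // le; case/andP: cC.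
Qed.

(** The bound of [edges_out_ge] improves by one because the parent edge of [w] does not come from
    [C]. *)
Lemma edges_out_gt r par h A C w : rooted_at e r par h -> r \in C -> C \subset A ->
  A \subset interior e -> w \in A -> w != r -> par w \notin C ->
  d.-1 * #|C| + 3 <= edges e C (~: A) + #|A|.
Proof.
move=> rt rC sCA sA wA wr pw.
have rA : r \in A by apply: (subsetP sCA).
have le1 : #|[set x in A | (x != r) && (par x \in C)]| <= #|A|.-2.
  have -> : #|A|.-2 = #|A :\ r :\ w|.
    by rewrite (cardsD1 r A) (cardsD1 w (A :\ r)) !inE rA wr wA.
  apply/subset_leq_card/subsetP => x; rewrite !inE => /and3P[xA xr px].
  by rewrite xr xA !andbT; apply: contraNneq pw => <-.
have le2 : #|[set x in C | (x != r) && (par x \in A)]| <= #|C|.-1.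
  rewrite [#|C|](cardsD1 r) rC; apply/subset_leq_card/subsetP => x.
  by rewrite !inE => /and3P[-> -> _].
have a2 : 2 <= #|A|.
  by rewrite (cardsD1 r A) (cardsD1 w (A :\ r)) !inE rA wr wA.
have c1 : 0 < #|C| by apply/card_gt0P; exists r.
have le : edges e C A <= #|A|.-2 + #|C|.-1 by rewrite (rooted_edges _ _ rt) leq_add.
have := edges_setC e C A; have := degree_sum_ge cl (subset_trans sCA sA).
case: d d_ge2 => // d' _ /=; rewrite mulSn; card_lia.
Qed.

(** Take for [C] the interior without its lightest vertex, for [A] the whole interior: the exact
    edge count leaves a degree sum of at most [d * #|C|], while each degree is at least [d]. *)
Lemma degree_eq z : z \in interior e -> (forall y, y \in interior e -> (f z <= f y)%R) ->
  forall v, v \in interior e -> v != z -> deg e v = d.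
Proof.
move=> zi zmin v vi vz; have [[tr _ _ i0] ik dmin] := cl.
pose C := interior e :\ z.
have cC : #|C| = k.-1 by have := cardsD1 z (interior e); rewrite zi ik /C; card_lia.
have vC : v \in C by rewrite !inE vz; move: vi; rewrite inE.
have C0 : C != set0 by apply/set0Pn; exists v.
have sC : C \subset interior e by apply: subsetDl.
have k1 : 1 < k by have : 0 < #|C| by [rewrite card_gt0]; rewrite cC; card_lia.
have upC x y : x \in C -> y \notin C -> (f y <= f x)%R.
  move=> xC; rewrite in_setD1 negb_and negbK => /orP[/eqP->|yi].
    by apply: zmin; move: xC; rewrite in_setD1 => /andP[].
  by rewrite f_boundary.
have upI x y : x \in interior e -> y \notin interior e -> (f y < f x)%R.
  by move=> xi yi; rewrite (f_boundary yi) f_gt0.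
have ck : #|C| < k by rewrite cC; lia.
have [/(_ sC ck) out _] := extremal_edges C0 i0 sC (subxx _) upC upI.
have [par [rt _]] := tree_rooted v tr.
have := edges_in_le rt vC sC; have := edges_setC e C (interior e).
rewrite out cC ik (bigD1 v) //=.
have : d * k.-2 <= \sum_(i in C | i != v) deg e i.
  have -> : k.-2 = #|C :\ v| by rewrite -cC (cardsD1 v C) vC.
  rewrite mulnC -sum_nat_const [X in X <= _](eq_bigl (fun i => (i \in C) && (i != v))); last first.
    by move=> i; rewrite in_setD1 andbC.
  by apply: leq_sum => i /andP[iC _]; apply: dmin; apply: (subsetP sC).
have := dmin v vi; clear -d_ge2 k1.
case: k k1 => [|[|k']] // _; case: d d_ge2 => [|[|d']] //= _.
rewrite !mulSn !mulnS; move: (\sum_(_ in _ | _) _) (edges _ _ _) => S E.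
by lia.
Qed.

Variables (x0 : V) (par : V -> V).
Hypothesis x0_max : forall v, (f v <= f x0)%R.
Hypothesis rt : rooted_at e x0 par (height e x0).

Let x0_int : x0 \in interior e.
Proof.
have [[_ _ _ /set0Pn[y yi]] _ _] := cl.
by rewrite -f_gt0; apply: lt_le_trans (x0_max y); rewrite f_gt0.
Qed.

Let par_int v : v != x0 -> par v \in interior e.
Proof. exact: rooted_par_interior rt x0_int v. Qed.

(** Otherwise the superlevel set at [f v] contains [v] but not its parent, and [edges_out_gt]
    exceeds the exact count. *)
Lemma weight_par_ge v : v != x0 -> (f v <= f (par v))%R.
Proof.
move=> vx; have [vi|vi] := boolP (v \in interior e); last by rewrite f_boundary.
pose A := [set w | (f v <= f w)%R].
have vA : v \in A by rewrite inE.
have xA : x0 \in A by rewrite inE.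
have A0 : A != set0 by apply/set0Pn; exists v.
have sA : A \subset interior e.
  by apply/subsetP => w; rewrite inE -!f_gt0; apply: lt_le_trans; rewrite f_gt0.
have upA x y : x \in A -> y \notin A -> (f y < f x)%R.
  by rewrite !inE -ltNge => vx' yv; apply: lt_le_trans vx'.
have [_ ik _] := cl.
suff : par v \in A by rewrite inE.
apply: contraT => pA.
have ak : #|A| < k.
  rewrite -ik; apply: proper_card; apply/properP; split=> //.
  by exists (par v) => //; apply: par_int.
have [+ _] := extremal_edges A0 A0 sA sA (fun x y xA yA => ltW (upA x y xA yA)) upA.
move=> /(_ (subxx _) ak) out.
have := edges_out_gt rt xA (subxx _) sA vA vx pA; rewrite out.
have : 0 < #|A| by rewrite card_gt0.
case: d d_ge2 => [|[|d']] //= _; rewrite mulSn; card_lia.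
Qed.

(** If [w2] were heavier, let [C] consist of the vertices heavier than [v] and of [x0] and [u],
    which may tie with [v]; let [A] be the superlevel set at [f w2]. The parent [v] of [w2] is
    outside [C], so [edges_out_gt] contradicts the exact count. *)
Lemma weight_children u v w1 w2 : u != v -> v != x0 -> (f v <= f u)%R ->
  w1 != x0 -> w2 != x0 -> par w1 = u -> par w2 = v -> (f w2 <= f w1)%R.
Proof.
move=> uv vx fvu w1x w2x p1 p2; rewrite leNgt; apply/negP => lt12.
have [_ ik _] := cl; have [_ eE] := rt.
have ui : u \in interior e by rewrite -p1 par_int.
have vi : v \in interior e by rewrite -p2 par_int.
pose C := [set z | (f v < f z)%R] :|: [set x0; u]; pose A := [set z | (f w2 <= f z)%R].
have CP z : z \in C -> (f v <= f z)%R.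
  by rewrite !inE => /orP[/ltW//|/orP[]/eqP->].
have vC : v \notin C by rewrite !inE ltxx /= negb_or vx eq_sym uv.
have upC x y : x \in C -> y \notin C -> (f y <= f x)%R.
  by move=> /CP vx'; rewrite !inE negb_or -leNgt => /andP[yv _]; apply: le_trans vx'.
have sC : C \subset interior e.
  apply/subsetP => z /CP; rewrite -f_gt0; apply: lt_le_trans; by rewrite f_gt0.
have xC : x0 \in C by rewrite !inE eqxx orbT.
have uC : u \in C by rewrite !inE eqxx !orbT.
have C0 : C != set0 by apply/set0Pn; exists u.
have ck : #|C| < k.
  by rewrite -ik; apply: proper_card; apply/properP; split=> //; exists v.
have upA x y : x \in A -> y \notin A -> (f y < f x)%R.
  by rewrite !inE -ltNge => vx' yv; apply: lt_le_trans vx'.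
have sA : A \subset interior e.
  apply/subsetP => z; rewrite inE -f_gt0; apply: lt_le_trans.
  exact: le_lt_trans lt12.
have w2A : w2 \in A by rewrite inE.
have A0 : A != set0 by apply/set0Pn; exists w2.
have CA : C \subset A.
  apply/subsetP => z /CP vz; rewrite inE; apply: le_trans vz.
  by rewrite -p2 weight_par_ge.
have [/(_ CA ck) out _] := extremal_edges C0 A0 sC sA upC upA.
have w1A : w1 \notin A by rewrite inE -ltNge.
(* The exact count is a truncated difference; the edge from [u] to [w1] leaves [A], so nothing is
   truncated. *)
have out_gt0 : 0 < edges e C (~: A).
  rewrite /edges (bigD1 u) //= (bigD1 w1) ?inE //=; last by move: w1A; rewrite inE.
  by rewrite eE w1x p1 eqxx.
have p2C : par w2 \notin C by rewrite p2.
have := edges_out_gt rt xC CA sA w2A w2x p2C.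
by rewrite out subnK ?leq_add2l // ltnW // -subn_gt0 -out.
Qed.

End EqualityCase.

(** * The SLO*-ordering of a tree attaining the minimum *)

Section ExtremalStructure.
Variables (R : realType) (n k d : nat) (e : rel 'I_n) (l : R) (f : 'I_n -> R).
Notation V := 'I_n.
Implicit Types (u v w x y : V).

Lemma equality_SLOstar : 0 < k -> k < n -> 2 <= d -> in_class k d e ->
  ground_state e l f -> (forall v, (0 < f v)%R = (v \in interior e)) ->
  (forall g : V -> R, supported (@canon n k d) g ->
     (l * dot g g <= dform (@canon n k d) g g)%R) ->
  SLOstar_tree e /\ extremal_degrees d e.
Proof.
move=> k0 kn d2 cl gs f_gt0 cmin.
have [tb ik dmin] := cl; have [tr deg1 _ i0] := tb; have [_ conn _] := tr.
have f_bd v : v \notin interior e -> f v = 0%R by case: (gs) => sf _ _ _ /sf.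
have bd v : (v \in boundary e) = (v \notin interior e).
  by rewrite !inE -leqNgt eqn_leq deg1 andbT.
have [x0 x0_max] : exists x0, forall v, (f v <= f x0)%R.
  have /set0Pn[y _] := i0.
  by case: (arg_maxP (P := predT) f (i0 := y)) => // x0 _ x0m; exists x0 => v; apply: x0m.
have [z zi zmin] : exists2 z, z \in interior e & forall y, y \in interior e -> (f z <= f y)%R.
  have /set0Pn[y yi] := i0.
  by case: (arg_minP (P := [in interior e]) f yi) => z zi zm; exists z.
have degz := degree_eq k0 kn d2 cl gs f_gt0 cmin.
have [par [rt hE]] := tree_rooted x0 tr; have [hpar eE] := rt.
have kids := weight_children k0 kn d2 cl gs f_gt0 cmin x0_max rt.
have [prec [sto pfirst pf pw ptie]] := parent_order_exists hpar x0_max.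
have [irr trans tot] := sto.
have childP u w : child e x0 u w -> w != x0 /\ par w = u.
  case/andP; rewrite eE => /orP[/andP[wx /eqP//]|/andP[/hE uE /eqP wE]] /eqP.
  by rewrite uE wE; card_lia.
have S2 u v w1 w2 : prec u v -> w1 != x0 -> w2 != x0 -> par w1 = u -> par w2 = v -> prec w1 w2.
  move=> uv w1x w2x p1 p2.
  have vx : v != x0 by apply: contraTneq uv => ->.
  have nuv : u != v by apply: contraTneq uv => ->.
  have := kids u v w1 w2 nuv vx (pf _ _ uv) w1x w2x p1 p2.
  rewrite le_eqVlt => /orP[/eqP fE|]; last exact: pw.
  by apply: ptie => //; rewrite p1 p2.
split; last first.
  exists z => //; split=> [|v vi vz]; last exact: degz zi zmin v vi vz.
  rewrite (bigD1 z) //= big1 => [|v /andP[vi vz]]; last by rewrite (degz z) ?subnn.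
  by rewrite addn0 subnKC // dmin.
split=> //; exists x0, prec; split; last first.
  move=> v w vi wi vw; have nvw : v != w by apply: contraTneq vw => ->.
  suff -> : deg e v = d by apply: dmin.
  have [vz|vz] := eqVneq v z; last exact: degz zi zmin v vi vz.
  (* Here [v = z] precedes [w], so [w] has minimal weight too and can take the exceptional role
     instead. *)
  apply: (degz w) => // y yi; apply: le_trans (zmin y yi); rewrite -vz; exact: pf.
split=> //.
(* S1 by induction on the height of [w]: were the parent of [w] before that of [v], S2 would put [w]
   before [v]. *)
- move=> v w; move: {2}(height e x0 w) (leqnn (height e x0 w)) => m.
  elim: m v w => [|m IH] v w hm vw.
    move: hm vw; rewrite leqn0 height_eq0 // => /eqP->.
    by rewrite (negPf (pfirst v)).
  have wx : w != x0 by apply: contraTneq vw => ->.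
  have [->|vx] := eqVneq v x0.
    by have /eqP-> : height e x0 x0 == 0 by rewrite height_eq0.
  rewrite (hE v) // (hE w) // ltnS.
  have [->//|/tot/orP[pvw|pwv]] := eqVneq (par v) (par w).
    by apply: IH => //; have := hE w wx; card_lia.
  have := trans _ _ _ vw (S2 _ _ _ _ pwv wx vx erefl erefl).
  by rewrite (negPf (irr v)).
- by move=> v1 v2 w1 w2 v12 /childP[w1x p1] /childP[w2x p2]; apply: S2 v12 w1x w2x p1 p2.
move=> v w vw; rewrite !bd => /f_bd fv; rewrite -f_gt0 -leNgt -fv; exact: pf.
Qed.

End ExtremalStructure.

(** * Optimality of the canonical tree and the characterisation *)

Lemma canon_lambda_min (R : realType) (n k d : nat) (e : rel 'I_n) (l l' : R) :
  0 < k -> k < n -> 2 <= d -> in_class k d e ->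
  is_lambda (@canon n k d) l -> is_lambda e l' -> (l <= l')%R.
Proof.
move=> k0 kn d2 cl; have [tb ik _] := cl; have [tr _ _ i0] := tb; have [sg _ _] := tr.
have clT := canon_in_class k0 kn d2 (class_size d2 cl).
have [[[sgT _ _] _ _ iT0] _ _] := clT.
move=> /is_lambdaP-/(_ sgT iT0)[fT gsT] /is_lambdaP-/(_ sg i0)[f' gs'].
have [l2 [f [gs f_gt0]]] := positive_ground_state R tb.
rewrite (ground_state_unique gs' gs) {l' f' gs'}.
have [s [smon sE]] : exists s : {perm 'I_n},
    (forall i j : 'I_n, i <= j -> (f (s j) <= f (s i))%R) /\
    forall i, (s i \in interior e) = (i < #|interior e|).
  apply: sorting_perm => u v; rewrite -!f_gt0 -leNgt => fu fv.
  exact: le_trans fv (ltW fu).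
rewrite ik in sE; have [fsup fpos fE _] := gs; have [_ _ _ Tmin] := gsT.
(* The sorted ground state of [e] serves as a test function on the canonical tree. *)
rewrite -(ler_pM2r fpos) -fE -(dot_relabel s f f).
apply: le_trans (Tmin _ (sorted_supported k0 kn d2 cl sE fsup)) _.
exact: canon_dform_le.
Qed.

Theorem theorem2 (R : realType) (n k d : nat) :
  1 <= k -> k <= n - 1 -> 2 <= d ->
  (forall e : rel 'I_n, in_class k d e ->
     (faber_krahn R k d e <-> (SLOstar_tree e /\ extremal_degrees d e))) /\
  (forall e e' : rel 'I_n, in_class k d e -> in_class k d e' ->
     SLOstar_tree e -> extremal_degrees d e ->
     SLOstar_tree e' -> extremal_degrees d e' -> graph_iso e e').
Proof.
move=> k0 kn1 d2; have kn : k < n by lia.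
split=> [e cl|e e' cl cl' slo ext slo' ext']; last first.
  (* Both trees are renumberings of the canonical one. *)
  have [rho rhoE] := SLOstar_canonical k0 kn d2 cl slo ext.
  have [rho' rhoE'] := SLOstar_canonical k0 kn d2 cl' slo' ext'.
  by exists (rho * rho'^-1)%g => x y; rewrite rhoE' rhoE !permM !permKV.
have [tb _ _] := cl; have [[sg _ _] _ _ i0] := tb.
have clT := canon_in_class k0 kn d2 (class_size d2 cl).
have [[[sgT _ _] _ _ iT0] _ _] := clT.
split=> [fk|[slo ext] e' cl' l l' le le'].
  have [l [f [gs f_gt0]]] := positive_ground_state R tb.
  have [lT [fT gsT]] := ground_state_exists R sgT iT0.
  apply: (equality_SLOstar k0 kn d2 cl gs) => // g sg'.
  have [_ _ _ Tmin] := gsT; apply: le_trans (Tmin g sg').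
  (* The Faber-Krahn property against the canonical tree gives [l <= lT]. *)
  rewrite ler_wpM2r ?dot_ge0 // (fk _ clT) //.
    by apply/is_lambdaP => //; exists f.
  by apply/is_lambdaP => //; exists fT.
have [rho rhoE] := SLOstar_canonical k0 kn d2 cl slo ext.
have [lT [fT gsT]] := ground_state_exists R sgT iT0.
have lamT : is_lambda (@canon n k d) lT by apply/is_lambdaP => //; exists fT.
have [lam1 lam2] := le; have [lamT1 lamT2] := is_lambda_iso sg i0 sgT iT0 rhoE lamT.
apply: le_trans (lam2 _ lamT1) _; exact: canon_lambda_min lamT le'.
Qed.
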